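(* Let $\rho_{AB}$ be a bipartite quantum state acting on a separable Hilbert space $\mathcal{H}_A\otimes\mathcal{H}_B$. Then its one-shot PPT exact entanglement cost is given by $$E^{(1)}_{\mathrm{PPT}}(\rho_{AB})=\inf\left\{\log_2 m:\ m\in\mathbb{N},\ G_{AB}\ge0,\ \operatorname{Tr}[G_{AB}]=1,\ -(m-1)G_{AB}^{T_B}\le\rho_{AB}^{T_B}\le(m+1)G_{AB}^{T_B}\right\}.$$
   Context: A bipartite state $\rho_{AB}$ is a positive semi-definite operator of unit trace on $\mathcal{H}_A\otimes\mathcal{H}_B$. The partial transpose with respect to a fixed orthonormal basis $\{|i\rangle_B\}_i$ is the linear map $T_B(X_{AB})=X_{AB}^{T_B}:=\sum_{i,j}(I_A\otimes|i\rangle\langle j|_B)X_{AB}(I_A\otimes|i\rangle\langle j|_B)$. A quantum channel is a completely positive trace-preserving map. A bipartite channel $\mathcal{N}_{AB\to A'B'}$ (Alice holds $A,A'$, Bob holds $B,B'$) is completely PPT-preserving (C-PPT-P), written $\mathcal{N}\in\mathrm{PPT}$, if $T_{B'}\circ\mathcal{N}_{AB\to A'B'}\circ T_B$ is completely positive. For $d\in\mathbb{N}=\{1,2,\dots\}$, the maximally entangled state of Schmidt rank $d$ is $\Phi^d_{\hat A\hat B}:=\frac1d\sum_{i,j=1}^d|i\rangle\langle j|_{\hat A}\otimes|i\rangle\langle j|_{\hat B}$, where $\hat A,\hat B$ have dimension $d$ with orthonormal bases $\{|i\rangle_{\hat A}\}_i$, $\{|i\rangle_{\hat B}\}_i$.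 One-shot PPT exact entanglement cost: $E^{(1)}_{\mathrm{PPT}}(\rho_{AB}):=\inf\{\log_2 d: d\in\mathbb{N},\ \Lambda_{\hat A\hat B\to AB}\in\mathrm{PPT},\ \rho_{AB}=\Lambda_{\hat A\hat B\to AB}(\Phi^d_{\hat A\hat B})\}$. The infimum of the empty set is $+\infty$. *)

(* Defs.v *)
From HB Require Import structures.
From mathcomp Require Import all_boot all_order all_algebra.
From mathcomp Require Import finmap complex.
From mathcomp Require Import all_classical all_reals all_analysis.
From mathcomp.analysis.showcase Require Import summability.
Set Implicit Arguments.
Unset Strict Implicit.
Unset Printing Implicit Defensive.
Import Order.TTheory GRing.Theory Num.Theory.
Import numFieldNormedType.Exports.
Local Open Scope classical_set_scope.
Local Open Scope ring_scope.

(* The inner product is linear in its second argument. *)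
HB.mixin Record CompleteNormedModule_isHilbert (R : realType) H
    of CompleteNormedModule R[i] H := {
  dotp : H -> H -> R[i] ;
  dotpP : forall (a : R[i]) (u v w : H),
    dotp u (a *: v + w) = a * dotp u v + dotp u w ;
  dotpC : forall u v : H, dotp u v = (dotp v u)^* ;
  dotpp : forall u : H, dotp u u = `|u| ^+ 2
}.

#[short(type="hilbertType")]
HB.structure Definition Hilbert (R : realType) :=
  {H of CompleteNormedModule R[i] H & CompleteNormedModule_isHilbert R H}.

Definition euclid (R : realType) (I : finType) := {ffun I -> R[i]}.

Section euclid_instances.
Variables (R : realType) (I : finType).
Local Notation C := (R[i]).
Local Notation E := (euclid R I).

HB.instance Definition _ := GRing.Lmodule.on E.

Let scaleE (a x : C) : a *: x = a * x. Proof. by []. Qed.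

Let edot (u v : E) : C := \sum_i (u i)^* * v i.

Let enorm (u : E) : C := sqrtC (edot u u).

Let rowE (u : E) : 'rV[C]_#|I| := \row_k u (enum_val k).

Let edot_row (u v : E) : edot u v = dotmx (rowE v) (rowE u).
Proof.
rewrite dotmxE mxE /edot (reindex _ (onW_bij _ (enum_val_bij I))) /=.
by apply: eq_bigr => k _; rewrite !mxE mulrC.
Qed.

Let rowD (u v : E) : rowE (u + v) = rowE u + rowE v.
Proof. by apply/rowP => k; rewrite !mxE ffunE. Qed.

Let rowZ a (u : E) : rowE (a *: u) = a *: rowE u.
Proof. by apply/rowP => k; rewrite !mxE ffunE. Qed.

Let enormD (u v : E) : enorm (u + v) <= enorm u + enorm v.
Proof. by rewrite /enorm !edot_row rowD; apply: (triangle_lerif (@dotmx _ _) _ _).1. Qed.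

Let enormZ (a : C) (u : E) : enorm (a *: u) = `|a| * enorm u.
Proof.
rewrite /enorm !edot_row rowZ (dnormZ (@dotmx _ _)).
by rewrite sqrtCM ?nnegrE ?exprn_ge0 ?sqrCK ?(dnorm_ge0 (@dotmx _ _)).
Qed.

Let enorm0 (u : E) : enorm u = 0 -> u = 0.
Proof.
move/eqP; rewrite sqrtC_eq0 edot_row (dnorm_eq0 (@dotmx _ _)) => /eqP/rowP u0.
by apply/ffunP => i; have := u0 (enum_rank i); rewrite !mxE enum_rankK ffunE.
Qed.

HB.instance Definition _ := Lmodule_isNormed.Build C E enormD enormZ enorm0.

Let normE (u : E) : `|u| = enorm u. Proof. by []. Qed.

Let edot_ge0 (u : E) : 0 <= edot u u.
Proof. by apply: sumr_ge0 => j _; rewrite mulrC mul_conjC_ge0. Qed.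

Let coord_le (u : E) i : `|u i| <= `|u|.
Proof.
rewrite normE /enorm -(@sqrCK _ `|u i|)// ler_sqrtC ?nnegrE ?exprn_ge0//.
rewrite /edot (bigD1 i)//= normCKC lerDl sumr_ge0// => j _.
by rewrite mulrC mul_conjC_ge0.
Qed.

Let norm_le_sum (u : E) : `|u| <= \sum_i `|u i|.
Proof.
have s0 : 0 <= \sum_i `|u i| by apply: sumr_ge0.
rewrite normE /enorm -(sqrCK s0) ler_sqrtC ?nnegrE ?exprn_ge0//.
rewrite /edot expr2 mulr_suml ler_sum// => i _.
rewrite mulrC -normCK expr2 ler_wpM2l// (bigD1 i)//= lerDl sumr_ge0//.
Qed.

Let normc_le (z : C) : `|z| <= (`|complex.Re z| + `|complex.Im z|)%:C%C.
Proof.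
rewrite [in X in X <= _](complexE z) (le_trans (ler_normD _ _))// rmorphD.
by rewrite lerD// ?normrM ?normc_def /= ?expr0n ?expr1n /= ?addr0 ?add0r
  ?sqrtr_sqr ?sqrtr1 ?mul1r.
Qed.

Let Re_le (z : C) : `|complex.Re z|%:C%C <= `|z|.
Proof. exact: normc_ge_Re. Qed.

Let Im_le (z : C) : `|complex.Im z|%:C%C <= `|z|.
Proof.
case: z => a b; rewrite normc_def /= lecR -sqrtr_sqr ler_wsqrtr//.
by rewrite lerDr sqr_ge0.
Qed.

Let coord_cvg (f : C -> R) (F0 : set_system E) (i : I) :
  (forall x y, f (x - y) = f x - f y) ->
  (forall x, `|f x|%:C%C <= `|x|) ->
  ProperFilter F0 -> cauchy F0 -> cvg ((fun u : E => f (u i)) @ F0).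
Proof.
move=> fB fle FF /cauchy_ballP cF; apply: cauchy_cvg; apply/cauchy_ballP => e e0.
have e0' : 0 < e%:C%C by rewrite ltcR.
have [[A B] /= [FA FB] AB] := cF _ e0'.
exists ((fun u : E => f (u i)) @` A, (fun u : E => f (u i)) @` B) => /=.
  by split; [apply: filterS FA => x|apply: filterS FB => x] => ?; exists x.
move=> [x y] /= [[u Au <-] [v Bv <-]].
have := AB (u, v) (conj Au Bv); rewrite -!ball_normE /= => uv.
rewrite -fB -ltcR (le_lt_trans _ uv)//.
have -> : u i - v i = (u - v) i by rewrite !ffunE.
exact: le_trans (fle _) (coord_le _ _).
Qed.

Let euclid_complete (F0 : set_system E) :
  ProperFilter F0 -> cauchy F0 -> cvg F0.
Proof.
move=> FF cF.
have cRe i : cvg ((fun u : E => complex.Re (u i)) @ F0).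
  by apply: coord_cvg Re_le FF cF => -[? ?] [].
have cIm i : cvg ((fun u : E => complex.Im (u i)) @ F0).
  by apply: coord_cvg Im_le FF cF => -[? ?] [].
pose l : E := [ffun i => Complex (lim ((fun u : E => complex.Re (u i)) @ F0))
                                 (lim ((fun u : E => complex.Im (u i)) @ F0))].
apply/cvg_ex; exists l; apply/cvgrPdist_lt => e e0.
pose e' := complex.Re e.
have eE : e = e'%:C%C.
  by move: e0; rewrite ltcE /e' => /andP[/eqP]; case: (e) => a b /= ->.
have e'0 : 0 < e' by rewrite -ltcR -eE.
pose k : R := (#|I|.+1)%:R *+ 2.
have k0 : 0 < k by rewrite pmulrn_lgt0.
have ek0 : 0 < e' / k by rewrite divr_gt0.
have nRe : {near F0, forall u : E, forall i, `|complex.Re (l i) - complex.Re (u i)| < e' / k}.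
  apply: filter_forall => i; rewrite ffunE /=.
  by have /cvgrPdist_lt/(_ _ ek0) := cRe i.
have nIm : {near F0, forall u : E, forall i, `|complex.Im (l i) - complex.Im (u i)| < e' / k}.
  apply: filter_forall => i; rewrite ffunE /=.
  by have /cvgrPdist_lt/(_ _ ek0) := cIm i.
near=> u.
rewrite (le_lt_trans (norm_le_sum _))// eE.
apply: (@le_lt_trans _ _ (\sum_(i : I) (e' / k *+ 2)%:C%C)).
  apply: ler_sum => i _; rewrite (le_trans (normc_le _))// lecR mulr2n.
  have -> : (l - u) i = l i - u i by rewrite !ffunE.
  have -> : complex.Re (l i - u i) = complex.Re (l i) - complex.Re (u i).
    by case: (l i) (u i) => ? ? [].
  have -> : complex.Im (l i - u i) = complex.Im (l i) - complex.Im (u i).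
    by case: (l i) (u i) => ? ? [].
  by apply: lerD; rewrite ltW//; move: i; near: u.
rewrite -rmorph_sum ltcR sumr_const -mulrnA -mulr_natr mulrAC ltr_pdivrMr//.
rewrite ltr_pM2l// /k -mulrnA ltr_nat.
by rewrite mulnC ltn_mul2r/=.
Unshelve. all: by end_near. Qed.

HB.instance Definition _ := Uniform_isComplete.Build E euclid_complete.


Let edotP (a : C) (u v w : E) :
  edot u (a *: v + w) = a * edot u v + edot u w.
Proof.
rewrite /edot mulr_sumr -big_split; apply: eq_bigr => i _.
by rewrite !ffunE scaleE mulrDr mulrCA.
Qed.

Let edotC (u v : E) : edot u v = (edot v u)^*.
Proof.
rewrite /edot raddf_sum; apply: eq_bigr => i _.
by rewrite /= rmorphM /= conjCK mulrC.
Qed.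

Let edotp (u : E) : edot u u = `|u| ^+ 2.
Proof. by rewrite normE /enorm sqrtCK. Qed.

HB.instance Definition _ :=
  CompleteNormedModule_isHilbert.Build R E edotP edotC edotp.

Lemma dotp_euclidE (u v : E) : dotp u v = \sum_i (u i)^* * v i.
Proof. by []. Qed.

End euclid_instances.

Definition separable (T : topologicalType) :=
  exists2 D : set T, countable D & dense D.

Section operators.
Variables (R : realType) (H : hilbertType R).
Local Notation C := R[i].

Definition orthonormal_family (I : eqType) (e : I -> H) :=
  forall i j, dotp (e i) (e j) = (i == j)%:R.

Definition onb (I : eqType) (e : I -> H) :=
  orthonormal_family e /\ forall v, (forall i, dotp (e i) v = 0) -> v = 0.

(* Operators are plain functions H -> H, so that they carry the pointwise
   lmodType structure and Leibniz equality of operators is extensional. *)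
Definition bounded_linear (X : H -> H) :=
  linear X /\ exists M : C, forall v, `|X v| <= M * `|v|.

Definition psd (X : H -> H) :=
  bounded_linear X /\ forall v, 0 <= dotp v (X v).

Definition ople (X Y : H -> H) := psd (Y - X).

(* Finiteness of the trace norm, by its variational formula
   sup { sum_k |<u_k, X v_k>| : (u_k), (v_k) finite orthonormal families }. *)
Definition trace_class (X : H -> H) :=
  bounded_linear X /\
  exists c : C, forall n (u v : 'I_n -> H),
    orthonormal_family u -> orthonormal_family v ->
    \sum_(k < n) `|dotp (u k) (X (v k))| <= c.

(* X is trace class and Tr X = t; the diagonal sum is unconditional (the net of
   finite partial sums converges) and has value t in every orthonormal basis. *)
Definition has_trace (X : H -> H) (t : C) :=
  trace_class X /\
  forall (I : choiceType) (e : I -> H), onb e ->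
    partial_sum (fun i => dotp (e i) (X (e i)) : C^o) @ totally --> (t : C^o).

Definition is_state (rho : H -> H) := psd rho /\ has_trace rho 1.

(* Positivity of an n x n matrix of operators on H, as an operator on the
   direct sum of n copies of H. *)
Definition block_psd n (X : 'I_n -> 'I_n -> H -> H) :=
  forall v : 'I_n -> H,
    0 <= \sum_(k < n) \sum_(l < n) dotp (v k) (X k l (v l)).

End operators.

Section channels.
Variables (R : realType) (H K : hilbertType R).

(* Maps of operators are total functions; only their values on trace-class
   operators are constrained. *)
Definition completely_positive (N : (H -> H) -> (K -> K)) :=
  forall n (X : 'I_n -> 'I_n -> H -> H),
    (forall k l, trace_class (X k l)) ->
    block_psd X -> block_psd (fun k l => N (X k l)).

Record channel (N : (H -> H) -> (K -> K)) : Prop := Channel {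
  channel_linear : forall (a : R[i]) (X Y : H -> H),
    trace_class X -> trace_class Y -> N (a *: X + Y) = a *: N X + N Y ;
  channel_trace_class : forall X, trace_class X -> trace_class (N X) ;
  channel_trace : forall X t, has_trace X t -> has_trace (N X) t ;
  channel_cp : completely_positive N
}.

End channels.

(* A model of the Hilbert space tensor product; it is unique up to a unitary
   commuting with tens. *)
Record tensorProduct (R : realType) (HA HB : hilbertType R) := TensorProduct {
  tspace :> hilbertType R ;
  tens : HA -> HB -> tspace ;
  tensPl : forall (a : R[i]) (u v : HA) (w : HB),
    tens (a *: u + v) w = a *: tens u w + tens v w ;
  tensPr : forall (a : R[i]) (u : HA) (v w : HB),
    tens u (a *: v + w) = a *: tens u v + tens u w ;
  dotp_tens : forall (u u' : HA) (v v' : HB),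
    dotp (tens u v) (tens u' v') = dotp u u' * dotp v v' ;
  tens_dense : dense [set w : tspace | exists n (u : 'I_n -> HA) (v : 'I_n -> HB),
    w = \sum_(k < n) tens (u k) (v k)]
}.
Arguments tens {R HA HB} t.

(* X^{T_B} = sum_(i, j) (1 (x) |i><j|) X (1 (x) |i><j|), as the bounded operator
   with matrix elements <a (x) i| X^{T_B} |a' (x) j> = <a (x) j| X |a' (x) i>.
   There is at most one such operator, and there is one for X trace class;
   otherwise the value may be the default 0. *)
Definition ptranspose (R : realType) (HA HB : hilbertType R)
    (T : tensorProduct HA HB) (I : Type) (eB : I -> HB) (X : T -> T) : T -> T :=
  xget 0 [set Y : T -> T | bounded_linear Y /\
    forall (a a' : HA) (i j : I),
      dotp (tens T a (eB i)) (Y (tens T a' (eB j))) =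
      dotp (tens T a (eB j)) (X (tens T a' (eB i)))].

(* Meant for finite-dimensional inputs, where X^{T_B} is always trace class. *)
Definition ppt_channel (R : realType) (HA HB HA' HB' : hilbertType R)
    (T : tensorProduct HA HB) (T' : tensorProduct HA' HB')
    (I I' : Type) (eB : I -> HB) (eB' : I' -> HB')
    (N : (T -> T) -> (T' -> T')) :=
  channel N /\
  completely_positive (fun X : T -> T => ptranspose eB' (N (ptranspose eB X))).

Section euclid_tensor.
Variables (R : realType) (I J : finType).

Definition ket (i : I) : euclid R I := [ffun k => (k == i)%:R].

Lemma onb_ket : onb ket.
Proof.
split=> [i j|v v0].
  rewrite dotp_euclidE (bigD1 i)//= !ffunE eqxx rmorph1 mul1r big1 ?addr0//.
  by move=> k /negbTE ki; rewrite !ffunE ki rmorph0 mul0r.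
apply/ffunP => i; rewrite ffunE -(v0 i) dotp_euclidE (bigD1 i)//= !ffunE eqxx.
rewrite rmorph1 mul1r big1 ?addr0// => k /negbTE ki.
by rewrite !ffunE ki rmorph0 mul0r.
Qed.

Let etens (u : euclid R I) (v : euclid R J) : euclid R (I * J)%type :=
  [ffun p => u p.1 * v p.2].

Let etensPl (a : R[i]) u v w : etens (a *: u + v) w = a *: etens u w + etens v w.
Proof. by apply/ffunP => p; rewrite !ffunE /GRing.scale /= mulrDl mulrA. Qed.

Let etensPr (a : R[i]) u v w : etens u (a *: v + w) = a *: etens u v + etens u w.
Proof. by apply/ffunP => p; rewrite !ffunE /GRing.scale /= mulrDr mulrCA. Qed.

Let dotp_etens u u' v v' :
  dotp (etens u v) (etens u' v') = dotp u u' * dotp v v'.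
Proof.
rewrite !dotp_euclidE mulr_suml.
transitivity (\sum_i \sum_j (etens u v (i, j))^* * etens u' v' (i, j)).
  by rewrite pair_bigA; apply: eq_bigr => -[].
apply: eq_bigr => i _; rewrite mulr_sumr; apply: eq_bigr => j _.
by rewrite !ffunE rmorphM mulrACA.
Qed.

Let etens_dense : dense [set w : euclid R (I * J)%type |
  exists n (u : 'I_n -> euclid R I) (v : 'I_n -> euclid R J),
    w = \sum_(k < n) etens (u k) (v k)].
Proof.
move=> O [w Ow] _; exists w; split=> //=.
exists #|{: I * J}|, (fun k => w (enum_val k) *: ket (enum_val k).1).
exists (fun k => [ffun j => (j == (enum_val k).2)%:R]).
transitivity (\sum_(p : I * J)
    etens (w p *: ket p.1) [ffun j => (j == p.2)%:R]); last first.
  by rewrite (reindex _ (onW_bij _ (enum_val_bij _))).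
apply/ffunP => p; rewrite sum_ffunE (bigD1 p)//= big1 => [|q qp].
  by rewrite !ffunE !eqxx addr0 !mulr1 /GRing.scale /= !mulr1.
rewrite !ffunE /GRing.scale /=; move: qp; rewrite -pair_eqE /= eq_sym [_ == q.2]eq_sym.
by rewrite negb_and => /orP[]/negbTE->; rewrite ?(mulr0, mul0r).
Qed.

Definition euclid_tensor : tensorProduct (euclid R I) (euclid R J) :=
  TensorProduct etensPl etensPr dotp_etens etens_dense.

End euclid_tensor.
Arguments ket {R I}.

Section cost.
Variable R : realType.

Definition log2 (x : R) : R := ln x / ln 2.

Definition qudits (d : nat) : tensorProduct (euclid R 'I_d) (euclid R 'I_d) :=
  euclid_tensor R 'I_d 'I_d.

(* |i><j| (x) |i><j| = |ii><jj| maps v to <jj|v> |ii>. *)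
Definition max_entangled (d : nat) : qudits d -> qudits d := fun v =>
  d%:R^-1 *: \sum_(i < d) \sum_(j < d)
    dotp (tens (qudits d) (ket j) (ket j)) v *: tens (qudits d) (ket i) (ket i).

Definition ppt_exact_cost (HA HB : hilbertType R) (T : tensorProduct HA HB)
    (I : Type) (eB : I -> HB) (rho : T -> T) : \bar R :=
  ereal_inf [set (log2 d%:R)%:E | d in [set d : nat | (0 < d)%N /\
    exists2 L : (qudits d -> qudits d) -> (T -> T),
      ppt_channel ket eB L & rho = L (@max_entangled d)]].

End cost.

(* Main.v *)
(* For a PPT channel L with L(Phi_d) = rho, put G = L((1 - Phi_d)/(d^2 - 1)). Partial
   transposition turns 1 +- F (F the swap, both operators positive) into
   1 +- d Phi_d, so positivity of T o L o T on 1 +- F gives the two inequalities.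
   Conversely X |-> Tr(Phi_d X) rho + Tr((1 - Phi_d) X) G is such a channel: its
   conjugate by partial transposition sends X to a combination of
   rho^T + (d - 1) G^T and (d + 1) G^T - rho^T with coefficients proportional to
   Tr((1 + F) X) and Tr((1 - F) X).
   The partial transpose of a positive trace class operator exists because
   sum_(ij) |i><j| X |i><j| converges strongly: Cauchy-Schwarz for <u, X v> bounds
   its matrix elements by diagonal sums, which the trace controls. *)

Require Import Defs.
From HB Require Import structures.
From mathcomp Require Import all_boot all_order all_algebra.
From mathcomp Require Import finmap complex.
From mathcomp Require Import all_classical all_reals all_analysis.
From mathcomp.analysis.showcase Require Import summability.
From mathcomp Require Import ring lra.
Set Implicit Arguments.
Unset Strict Implicit.
Unset Printing Implicit Defensive.
Import Order.TTheory GRing.Theory Num.Theory.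
Import numFieldNormedType.Exports.
Local Open Scope classical_set_scope.
Local Open Scope ring_scope.

(** * Hilbert spaces *)

(** For $s=\pm1$ a channel sends $1+sd\Phi$ to $(d^2-1)G+(1+sd)\rho$, which factors as
    $(d+1)((d-1)G+\rho)$ for $s=1$ and as $(d-1)((d+1)G-\rho)$ for $s=-1$; hence the constants $d-1$
    and $d+1$. The second factorisation is empty when $d=1$, which needs its own argument. In the
    converse, every coefficient is a functional $\operatorname{Tr}(MX)$ with $M\ge0$ in front of a
    fixed positive operator, so complete positivity becomes positivity of a Schur product. The
    obstacle is that $H_A$ and $H_B$ may be infinite-dimensional, where [ptranspose] is a choice
    with default 0: it can be computed only where existence and uniqueness are shown. On the output
    side it meets only combinations of [rho] and [G], so linearity on combinations of positive trace
    class operators suffices. *)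

Section conj.
Variable C : numClosedFieldType.
Implicit Types x y : C.

Lemma conjCD x y : (x + y)^* = x^* + y^*. Proof. exact: rmorphD. Qed.

Lemma conjCN x : (- x)^* = - x^*. Proof. exact: rmorphN. Qed.

Lemma conjCM x y : (x * y)^* = x^* * y^*. Proof. exact: rmorphM. Qed.

End conj.

Section positive_forms.
Variables (R : realType) (V : lmodType R[i]) (B : V -> V -> R[i]).
Local Notation C := R[i].
Implicit Types (u v w : V) (a : C).
Hypothesis Br : forall u a v w, B u (a *: v + w) = a * B u v + B u w.
Hypothesis Bl : forall u a v w, B (a *: u + v) w = a^* * B u w + B v w.
Hypothesis B0 : forall u, 0 <= B u u.

Let BDr u v w : B u (v + w) = B u v + B u w.
Proof. by rewrite -[v]scale1r Br mul1r scale1r. Qed.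

Let BDl u v w : B (v + w) u = B v u + B w u.
Proof. by rewrite -[v]scale1r Bl conjC1 mul1r scale1r. Qed.

Let B0r u : B u 0 = 0.
Proof. by apply: (addrI (B u 0)); rewrite -BDr !addr0. Qed.

Let B0l u : B 0 u = 0.
Proof. by apply: (addrI (B 0 u)); rewrite -BDl !addr0. Qed.

Let BZr u a v : B u (a *: v) = a * B u v.
Proof. by rewrite -[a *: v]addr0 Br B0r addr0. Qed.

Let BZl u a v : B (a *: v) u = a^* * B v u.
Proof. by rewrite -[a *: v]addr0 Bl B0l addr0. Qed.

(** The diagonal values are real, so the cross terms $aB(u,v)+\bar aB(v,u)$ of $B(av+u,av+u)$ are
    real; $a=1$ and $a=i$ together give the symmetry. *)
Lemma positive_form_hermitian u v : B u v = (B v u)^*.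
Proof.
have re z : (B z z)^* = B z z by apply/conj_Creal/ger0_real.
have B1 a : (a * B u v + a^* * B v u)^* = a * B u v + a^* * B v u.
  have E : B (a *: v + u) (a *: v + u) =
    B (a *: v) (a *: v) + (a * B u v + a^* * B v u) + B u u.
    by rewrite !BDr !BDl !BZr !BZl; ring.
  have := congr1 Num.conj E.
  by rewrite re {1}E (conjCD (_ + _)) conjCD !re => /addIr/addrI <-.
have := B1 1; have := B1 'i.
rewrite !conjCD !conjCM !conjCK conjCi conjC1 !mul1r.
set x := B u v; set y := B v u => e1 e2.
have nI : 'i != 0 :> C by rewrite neq0Ci.
have e3 : y^* - x^* = x - y.
  apply: (mulfI nI); rewrite !mulrBr; move: e1; rewrite !mulNr => e1.
  by rewrite -e1 addrC.
have n2 : (2 : C) != 0 by rewrite pnatr_eq0.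
apply: (mulfI n2).
have -> : 2 * x = (x - y) + (x + y) by ring.
by rewrite -e3 -e2; ring.
Qed.

(** The form may be degenerate, so nothing is divided: the test vector is $B(v,v)$ times the part of
    $u$ orthogonal to $v$, or the same with the roles exchanged. If both diagonal values vanish,
    $u-\overline{B(u,v)}v$ yields $-2|B(u,v)|^2\ge0$. *)
Lemma positive_form_cauchy_schwarz u v : `|B u v| ^+ 2 <= B u u * B v v.
Proof.
have E b s : B (b *: u + s *: v) (b *: u + s *: v) =
   b * b^* * B u u + s^* * b * (B u v)^* + s * b^* * B u v + s * s^* * B v v.
  by rewrite !(BDr, BDl, BZr, BZl) -positive_form_hermitian; ring.
have R0 z : (B z z)^* = B z z by apply/conj_Creal/ger0_real.
have [v0|] := boolP (0 < B v v).
  have := B0 (B v v *: u + (- (B u v)^*) *: v).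
  rewrite E conjCN conjCK R0.
  have -> : B v v * B v v * B u u + - B u v * B v v * (B u v)^* +
      - (B u v)^* * B v v * B u v + - (B u v)^* * - B u v * B v v =
      B v v * (B u u * B v v - B u v * (B u v)^*) by ring.
  by rewrite pmulr_rge0// subr_ge0 -normCK.
rewrite lt0r B0 andbT negbK => /eqP v0.
have [u0|] := boolP (0 < B u u).
  have := B0 ((- B u v) *: u + B u u *: v).
  rewrite E conjCN R0 v0.
  have -> : - B u v * - (B u v)^* * B u u + B u u * - B u v * (B u v)^* +
      B u u * - (B u v)^* * B u v + B u u * B u u * 0 =
      B u u * (0 - B u v * (B u v)^*) by ring.
  by rewrite pmulr_rge0// subr_ge0 -normCK mulr0.
rewrite lt0r B0 andbT negbK => /eqP u0.
have := B0 (1 *: u + (- (B u v)^*) *: v).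
rewrite E u0 v0 conjCN conjCK conjC1.
have -> : 1 * 1 * 0 + - B u v * 1 * (B u v)^* + - (B u v)^* * 1 * B u v +
   - (B u v)^* * - B u v * 0 = - (B u v * (B u v)^*) *+ 2 by ring.
by rewrite pmulrn_lge0// oppr_ge0 -normCK mul0r.
Qed.

End positive_forms.

Section dotp_theory.
Variables (R : realType) (H : hilbertType R).
Local Notation C := R[i].
Implicit Types (u v w : H) (a : C) (X Y : H -> H).

Lemma dotpDr u v w : dotp u (v + w) = dotp u v + dotp u w.
Proof. by rewrite -[v]scale1r dotpP mul1r scale1r. Qed.

Lemma dotp0r u : dotp u 0 = 0.
Proof. by apply: (addrI (dotp u 0)); rewrite -dotpDr !addr0. Qed.

Lemma dotpZr u a v : dotp u (a *: v) = a * dotp u v.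
Proof. by rewrite -[a *: v]addr0 dotpP dotp0r addr0. Qed.

Lemma dotpNr u v : dotp u (- v) = - dotp u v.
Proof. by rewrite -scaleN1r dotpZr mulN1r. Qed.

Lemma dotpBr u v w : dotp u (v - w) = dotp u v - dotp u w.
Proof. by rewrite dotpDr dotpNr. Qed.

Lemma dotpDl u v w : dotp (v + w) u = dotp v u + dotp w u.
Proof. by rewrite dotpC dotpDr conjCD -!dotpC. Qed.

Lemma dotp0l u : dotp 0 u = 0.
Proof. by rewrite dotpC dotp0r conjC0. Qed.

Lemma dotpZl u a v : dotp (a *: v) u = a^* * dotp v u.
Proof. by rewrite dotpC dotpZr conjCM -dotpC. Qed.

Lemma dotpNl u v : dotp (- v) u = - dotp v u.
Proof. by rewrite dotpC dotpNr conjCN -dotpC. Qed.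

Lemma dotpBl u v w : dotp (v - w) u = dotp v u - dotp w u.
Proof. by rewrite dotpDl dotpNl. Qed.

Lemma dotp_sumr (I : Type) (r : seq I) (P : pred I) (F : I -> H) u :
  dotp u (\sum_(i <- r | P i) F i) = \sum_(i <- r | P i) dotp u (F i).
Proof. exact: (big_morph _ (dotpDr u) (dotp0r u)). Qed.

Lemma dotp_suml (I : Type) (r : seq I) (P : pred I) (F : I -> H) u :
  dotp (\sum_(i <- r | P i) F i) u = \sum_(i <- r | P i) dotp (F i) u.
Proof. by apply: (big_morph (dotp^~ u)); [move=> v w; exact: dotpDl|exact: dotp0l]. Qed.

Lemma dotp_ge0 u : 0 <= dotp u u.
Proof. by rewrite dotpp exprn_ge0. Qed.

Lemma dotp_eq0 u : dotp u u = 0 -> u = 0.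
Proof. by rewrite dotpp => /eqP; rewrite expf_eq0 /= normr_eq0 => /eqP. Qed.

Lemma dotp_eq0r v : (forall u, dotp u v = 0) -> v = 0.
Proof. by move=> /(_ v)/dotp_eq0. Qed.

Lemma dotp_inj v w : (forall u, dotp u v = dotp u w) -> v = w.
Proof.
by move=> vw; apply/eqP; rewrite -subr_eq0; apply/eqP/dotp_eq0r => u;
  rewrite dotpBr vw subrr.
Qed.

Lemma psd_lin X : psd X -> linear X. Proof. by case=> -[]. Qed.

Lemma psd_hermitian X : psd X ->
  forall u v, dotp u (X v) = (dotp v (X u))^*.
Proof.
move=> [[Xl _] X0]; apply: (@positive_form_hermitian _ _ (fun u v => dotp u (X v))) => //.
- by move=> u a v w; rewrite Xl dotpP.
- by move=> a u v w; rewrite dotpDl dotpZl.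
Qed.

Lemma cauchy_schwarz u v : `|dotp u v| <= `|u| * `|v|.
Proof.
rewrite -(@ler_pXn2r _ 2)// ?nnegrE ?mulr_ge0// exprMn -!dotpp.
apply: (@positive_form_cauchy_schwarz _ _ (@dotp _ _)).
- by move=> x a y z; exact: dotpP.
- by move=> a x y z; rewrite dotpDl dotpZl.
- exact: dotp_ge0.
Qed.

End dotp_theory.

Section complex_real_part.
Variable R : realType.
Implicit Types x y : R[i].

Lemma ger0_ReE x : 0 <= x -> x = (complex.Re x)%:C%C.
Proof. by case: x => a b; rewrite lecE /= => /andP[/eqP->]. Qed.

Lemma ler_Re x y : x <= y -> complex.Re x <= complex.Re y.
Proof. by rewrite lecE => /andP[]. Qed.

Lemma ReD x y : complex.Re (x + y) = complex.Re x + complex.Re y.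
Proof. by case: x y => ? ? []. Qed.

End complex_real_part.

#[local] Existing Instance totally_filter.

(** * Unconditional sums and Riesz representation *)

Section completeness.
Variables (R : realType) (H : hilbertType R).
Local Notation C := R[i].

Lemma scalar_cvg_unique (T : Type) (F : set_system T) (FF : ProperFilter F)
    (f : T -> C) (a b : C) :
  (fun x => f x : C^o) @ F --> (a : C^o) ->
  (fun x => f x : C^o) @ F --> (b : C^o) -> a = b.
Proof.
move=> c1 c2.
by rewrite -(cvg_lim (@norm_hausdorff _ C^o) c1) -(cvg_lim (@norm_hausdorff _ C^o) c2).
Qed.

Lemma dotp_cvgr (T : Type) (F : set_system T) (FF : Filter F) (f : T -> H) l u :
  f @ F --> l -> (fun x => dotp u (f x) : C^o) @ F --> (dotp u l : C^o).
Proof.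
move=> /cvgrPdist_lt fl; apply/cvgrPdist_lt => e e0.
have k0 : 0 < `|u| + 1 by rewrite ltr_wpDl.
have := fl _ (divr_gt0 e0 k0); apply: filterS => x.
rewrite ltr_pdivlMr// => lx; rewrite -dotpBr.
apply: le_lt_trans (cauchy_schwarz _ _) _; apply: le_lt_trans lx.
by rewrite mulrC ler_wpM2l// lerDl.
Qed.

Lemma dotp_cvgl (T : Type) (F : set_system T) (FF : Filter F) (f : T -> H) l u :
  f @ F --> l -> (fun x => dotp (f x) u : C^o) @ F --> (dotp l u : C^o).
Proof.
move=> /cvgrPdist_lt fl; apply/cvgrPdist_lt => e e0.
have k0 : 0 < `|u| + 1 by rewrite ltr_wpDl.
have := fl _ (divr_gt0 e0 k0); apply: filterS => x.
rewrite ltr_pdivlMr// => lx; rewrite -dotpBl.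
apply: le_lt_trans (cauchy_schwarz _ _) _; apply: le_lt_trans lx.
by rewrite ler_wpM2l// lerDl.
Qed.

(** Domination is by blocks, as for orthogonal series: past a finite set that nearly attains the
    supremum of the sums of [g], every further block of [t] has small norm, so the net is Cauchy. *)
Lemma cvg_dominated_sum (I : choiceType) (t : I -> H) (g : I -> C) (c M : C) :
  0 <= c -> (forall i, 0 <= g i) ->
  (forall P : {fset I}, `|\sum_(i <- P) t i| ^+ 2 <= c * \sum_(i <- P) g i) ->
  (forall P : {fset I}, \sum_(i <- P) g i <= M) ->
  cvg (partial_sum t @ totally).
Proof.
move=> c0 g0 tg gM.
pose S (P : {fset I}) := complex.Re (\sum_(i <- P) g i).
have SE (P : {fset I}) : \sum_(i <- P) g i = (S P)%:C%C.
  by apply: ger0_ReE; apply: sumr_ge0.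
have hs : has_sup (range S).
  split; first by exists (S fset0); exists fset0.
  by exists (complex.Re M) => _ [P _ <-]; apply: ler_Re.
have psE P : partial_sum t P = \sum_(i <- P) t i by rewrite /partial_sum big_seq_fsetE.
apply: cauchy_cvg; apply: (@cauchy_exP _ H) => e e0.
have cE := ger0_ReE c0; set cr := complex.Re c in cE.
have eE := ger0_ReE (ltW e0); set er := complex.Re e in eE.
have er0 : 0 < er by rewrite -ltcR -eE.
have cr0 : 0 <= cr by rewrite -lecR -cE.
(* The added 1 covers $c=0$. *)
have d0 : 0 < er ^+ 2 / (cr + 1) by rewrite divr_gt0// ?exprn_gt0// ltr_wpDl.
have [_ [P0 _ <-] P0s] := sup_adherent d0 hs.
exists (partial_sum t P0); exists P0 => // P /= P0P.
rewrite -ball_normE /= !psE.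
have split_sum (V : nmodType) (h : I -> V) :
    \sum_(i <- P) h i = \sum_(i <- P0) h i + \sum_(i <- (P `\` P0)%fset) h i.
  rewrite -big_cat /=; apply: perm_big; apply: uniq_perm => //.
    rewrite cat_uniq !fset_uniq andbT /=; apply/hasPn => x.
    by rewrite inE => /andP[].
  move=> x; rewrite mem_cat inE; case: (boolP (x \in P0)) => //= xP0.
  exact: (fsubsetP P0P).
rewrite split_sum opprD addrA subrr add0r normrN.
rewrite -(@ltr_pXn2r _ 2)// ?nnegrE ?(ltW e0)//.
apply: le_lt_trans (tg _) _; rewrite SE cE eE -rmorphM -rmorphXn ltcR.
have : S P = S P0 + S (P `\` P0)%fset by rewrite /S split_sum ReD.
have := ub_le_sup hs.2 (imageT S P) => SPs SPE.
have lt1 : S (P `\` P0)%fset < er ^+ 2 / (cr + 1).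
  by move: P0s SPs; rewrite SPE; set s := sup _; lra.
have S0 : 0 <= S (P `\` P0)%fset by rewrite -lecR -SE sumr_ge0.
rewrite ltr_pdivlMr ?ltr_wpDl// in lt1; apply: le_lt_trans lt1.
by rewrite mulrC ler_wpM2l// lerDl.
Qed.

(** Up to a constant, [phi] below is $\|x-r\|^2$ for the vector $r$ sought, so $r$ is obtained as
    the limit of the filter of near-minimisers of [phi]. *)
Lemma riesz (f : H -> C) (M : C) :
  (forall a u v, f (a *: u + v) = a * f u + f v) ->
  (forall u, `|f u| <= M * `|u|) -> exists r, forall v, dotp r v = f v.
Proof.
move=> fl fM.
have f0 : f 0 = 0.
  have := fl 1 0 0; rewrite scaler0 addr0 mul1r => e.
  by apply: (addrI (f 0)); rewrite addr0 -e.
have fD u v : f (u + v) = f u + f v by rewrite -[u]scale1r fl mul1r scale1r.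
have fZ a u : f (a *: u) = a * f u by rewrite -[a *: u]addr0 fl f0 addr0.
pose phi x : C := dotp x x - (f x + (f x)^*).
have phiR x : phi x = (complex.Re (phi x))%:C%C.
  have /complex_realP[k ->] : phi x \is Num.real by
    rewrite CrealE /phi conjCD conjCN conjCD conjCK -dotpC [_^* + _]addrC.
  by [].
have phiD x t v : phi (x + t *: v) = phi x + t * t^* * dotp v v
    - (t * (f v - dotp x v) + t^* * (f v - dotp x v)^*).
  rewrite /phi fD fZ !dotpDr !dotpDl !dotpZr !dotpZl !conjCD conjCN conjCM.
  by rewrite -!(dotpC v x); ring.
have {}fM u : `|f u| <= `|M| * `|u|.
  have h1 := fM u; apply: (le_trans h1).
  by rewrite -{1}[M * _]ger0_norm ?normrM ?normr_id// (le_trans _ h1).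
have hi : has_inf (range (fun x => complex.Re (phi x))).
  split; first by exists (complex.Re (phi 0)); exists 0.
  exists (complex.Re (- `|M| ^+ 2)) => _ [x _ <-]; apply: ler_Re.
  have fR : f x + (f x)^* <= `|M| * `|x| *+ 2.
    have : f x + (f x)^* \is Num.real by rewrite CrealE conjCD conjCK addrC.
    move=> /real_ler_norm h1; apply: le_trans h1 _.
    apply: le_trans (ler_normD _ _) _.
    by rewrite norm_conjC -mulr2n lerMn2r fM orbT.
  have h2 : 0 <= (`|x| - `|M|) ^+ 2 by rewrite real_exprn_even_ge0// realB// normr_real.
  rewrite /phi dotpp; apply: le_trans (lerB (lexx _) fR).
  rewrite -subr_ge0 opprK; move: h2; rewrite sqrrB.
  by rewrite [in X in _ -> is_true (_ <= X)]mulrC.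
pose m := inf (range (fun x => complex.Re (phi x))).
pose A (e : R) := [set x | complex.Re (phi x) < m + e].
(* Moving $x$ along $v$ by $t=\bar g/\langle v,v\rangle$, where $g=f(v)-\langle x,v\rangle$, lowers
   [phi] by $|g|^2/\langle v,v\rangle$; within $e$ of the infimum this drop is at most $e$. *)
have key e x v : 0 < e -> A e x -> `|f v - dotp x v| ^+ 2 <= e%:C%C * `|v| ^+ 2.
  move=> e0; rewrite /A /= => xe; rewrite -dotpp.
  set g := f v - dotp x v.
  have [v0|v0] := eqVneq v 0; first by rewrite /g v0 f0 !dotp0r subr0 normr0 expr0n mulr0.
  have n0 : 0 < dotp v v by rewrite dotpp exprn_gt0// normr_gt0.
  have := phiD x (g^* / dotp v v) v; rewrite -/g.
  have nR : ((dotp v v)^-1)^* = (dotp v v)^-1 by apply/conj_Creal/gtr0_real; rewrite invr_gt0.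
  rewrite conjCM conjCK nR => e1.
  have e2 : phi (x + (g^* / dotp v v) *: v) = phi x - g * g^* / dotp v v.
    by rewrite e1; field; rewrite gt_eqF.
  have : m <= complex.Re (phi (x + (g^* / dotp v v) *: v)).
    by apply: ge_inf hi.2 _ _; exists (x + (g^* / dotp v v) *: v).
  rewrite -lecR -phiR e2 => mle.
  move: xe; rewrite -ltcR -phiR (rmorphD (real_complex R)) /= => xe.
  rewrite normCK -(ler_pdivrMr _ _ n0); move: mle.
  rewrite lerBrDr addrC -lerBrDr => /le_trans; apply.
  by rewrite lerBlDl ltW.
have k e x v : 0 < e -> A (e ^+ 2) x -> `|f v - dotp x v| <= e%:C%C * `|v|.
  move=> e0 Ax; rewrite -(@ler_pXn2r _ 2)// ?nnegrE ?mulr_ge0//; last first.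
    by rewrite lecR ltW.
  have := key _ x v (exprn_gt0 2 e0) Ax.
  by rewrite exprMn (rmorphXn (real_complex R)).
pose F := filter_from [set e : R | 0 < e] A.
have FF : ProperFilter F.
  apply: filter_from_proper.
    apply: filter_from_filter; first by exists 1 => /=.
    move=> i j /= i0 j0; exists (Num.min i j); first by rewrite /= lt_min i0.
    move=> x; rewrite /A /= => xm; split; apply: lt_le_trans xm _;
      by rewrite lerD2l ge_min lexx ?orbT.
  move=> e /= e0; have [_ [x _ <-] xm] := inf_adherent e0 hi.
  by exists x.
have cF : cauchy F.
  apply: (@cauchy_exP _ H) => e e0.
  have eE := ger0_ReE (ltW e0); set er := complex.Re e in eE.
  have er0 : 0 < er by rewrite -ltcR -eE.
  have d1 : 0 < er / 4 by rewrite divr_gt0.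
  have d0 := exprn_gt0 2 d1.
  have [_ [x _ <-] xm] := inf_adherent d0 hi.
  exists x, ((er / 4) ^+ 2) => // y ym; rewrite -ball_normE /=.
  have [->|xy] := eqVneq x y; first by rewrite subrr normr0.
  have n0 : 0 < `|x - y| by rewrite normr_gt0 subr_eq0.
  rewrite -(ltr_pM2l n0) -expr2 -dotpp -[X in X < _]ger0_norm ?dotp_ge0//.
  (* Both points nearly represent [f], and testing on $x-y$ itself bounds their distance. *)
  have -> : dotp (x - y) (x - y) = (f (x - y) - dotp y (x - y)) -
    (f (x - y) - dotp x (x - y)) by rewrite [in LHS]dotpBl; ring.
  apply: le_lt_trans (ler_normB _ _) _.
  apply: le_lt_trans (lerD (k _ _ _ d1 ym) (k _ _ _ d1 xm)) _.
  rewrite -mulrDl mulrC ltr_pM2l// eE -rmorphD ltcR; lra.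
have /cvg_ex[r Fr] : cvg F by exact: cauchy_cvg.
exists r => v.
have c1 := @dotp_cvgl _ F _ id r v Fr.
suff c2 : (fun x => dotp x v : C^o) @ F --> (f v : C^o).
  exact: (@scalar_cvg_unique _ F _ (fun x => dotp x v)  _ _ (c1 _) c2).
apply/cvgrPdist_lt => e e0.
have k0 : 0 < `|v| + 1 by rewrite ltr_wpDl.
have d0 : 0 < e / (`|v| + 1) by rewrite divr_gt0.
have dE := ger0_ReE (ltW d0); set dr := complex.Re _ in dE.
have dr0 : 0 < dr by rewrite -ltcR -dE.
exists (dr ^+ 2) => [|x Ax]; first by rewrite /= exprn_gt0.
have : `|f v - dotp x v| <= dr%:C%C * `|v|.
  exact: k.
move=> /le_lt_trans; apply; rewrite -dE mulrAC ltr_pdivrMr//.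
by rewrite ltr_pM2l// ltrDl.
Qed.

End completeness.

Lemma ler_sum_subset (I : eqType) (F : numDomainType) (s t : seq I) (h : I -> F) :
  uniq s -> {subset s <= t} -> (forall i, 0 <= h i) ->
  \sum_(i <- s) h i <= \sum_(i <- undup t) h i.
Proof.
move=> us st h0.
have p : perm_eq (undup t) (s ++ [seq i <- undup t | i \notin s]).
  apply: uniq_perm; first exact: undup_uniq.
    rewrite cat_uniq us filter_uniq ?undup_uniq// andbT /=.
    by apply/hasPn => x; rewrite mem_filter => /andP[].
  move=> x; rewrite mem_cat mem_filter mem_undup.
  by case: (boolP (x \in s)) => //= xs; rewrite st.
by rewrite (perm_big _ p) big_cat /= lerDl sumr_ge0.
Qed.

Section bounded_operators.
Variables (R : realType) (H : hilbertType R).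
Local Notation C := R[i].
Implicit Types (X Y : H -> H) (a : C).

Lemma bounded_linearP X : bounded_linear X ->
  exists2 M : C, 0 <= M & forall v, `|X v| <= M * `|v|.
Proof.
case=> _ [M XM]; exists `|M| => // v; have h := XM v; apply: (le_trans h).
by rewrite -{1}[M * _]ger0_norm ?normrM ?normr_id// (le_trans _ h).
Qed.

Lemma bounded_linear0 : bounded_linear (0 : H -> H).
Proof.
split=> [a u v|]; first by rewrite -[RHS]/(a *: 0 + 0) scaler0 addr0.
by exists 0 => v; rewrite normr0 mul0r.
Qed.

Lemma bounded_linearPZ a X Y :
  bounded_linear X -> bounded_linear Y -> bounded_linear (a *: X + Y).
Proof.
move=> bX bY; have [M M0 XM] := bounded_linearP bX; have [N N0 YN] := bounded_linearP bY.
split.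
  move=> b u v; rewrite !fctE bX.1 bY.1 !scalerDr !scalerA addrACA.
  by rewrite (mulrC a b).
exists (`|a| * M + N) => v; rewrite fctE mulrDl (le_trans (ler_normD _ _))// lerD//.
by rewrite normrZ -mulrA ler_wpM2l.
Qed.

Lemma linear_op0 X : linear X -> X 0 = 0.
Proof.
move=> Xl; have := Xl 1 0 0; rewrite !scale1r addr0 => e.
by apply: (addrI (X 0)); rewrite addr0 -e.
Qed.

Lemma linear_opD X : linear X -> {morph X : u v / u + v}.
Proof. by move=> Xl u v; rewrite -[u]scale1r Xl !scale1r. Qed.

Lemma linear_opZ X : linear X -> forall a u, X (a *: u) = a *: X u.
Proof. by move=> Xl a u; rewrite -[a *: u]addr0 Xl linear_op0// addr0. Qed.

Lemma linear_op_sum X (I : Type) (r : seq I) (P : pred I) (F : I -> H) :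
  linear X -> X (\sum_(i <- r | P i) F i) = \sum_(i <- r | P i) X (F i).
Proof. by move=> Xl; apply: big_morph; [exact: linear_opD|exact: linear_op0]. Qed.

Lemma adjoint_ex X : bounded_linear X ->
  forall w, exists r, forall v, dotp r v = dotp w (X v).
Proof.
move=> bX w; have [M M0 XM] := bounded_linearP bX.
apply: (@riesz _ _ _ (`|w| * M)) => [a u v|u]; first by rewrite bX.1 dotpP.
by rewrite (le_trans (cauchy_schwarz _ _))// -mulrA ler_wpM2l.
Qed.

(** The sum is a single positive form, in general degenerate, on the space of families [I -> H]. *)
Lemma psd_sum_cauchy_schwarz X (I : Type) (s : seq I) (x y : I -> H) : psd X ->
  `|\sum_(p <- s) dotp (x p) (X (y p))| ^+ 2 <=
  (\sum_(p <- s) dotp (x p) (X (x p))) * (\sum_(p <- s) dotp (y p) (X (y p))).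
Proof.
move=> [[Xl _] X0].
apply: (@positive_form_cauchy_schwarz _ (I -> H)
  (fun x y => \sum_(p <- s) dotp (x p) (X (y p)))) => [u a v w|u a v w|u].
- by rewrite mulr_sumr -big_split; apply: eq_bigr => p _; rewrite !fctE Xl dotpP.
- by rewrite mulr_sumr -big_split; apply: eq_bigr => p _; rewrite !fctE dotpDl dotpZl.
- exact: sumr_ge0.
Qed.

Lemma scalar_cvg_norm_le (T : Type) (F : set_system T) (FF : ProperFilter F)
    (f : T -> C) (a K : C) : 0 <= K ->
  (fun x => f x : C^o) @ F --> (a : C^o) -> (forall x, `|f x| <= K) -> `|a| <= K.
Proof.
move=> K0 /cvgrPdist_lt fa fK.
rewrite real_leNgt ?ger0_real//; apply/negP => Ka.
have d0 : 0 < `|a| - K by rewrite subr_gt0.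
have [x /=] := filter_ex (fa _ d0).
rewrite ltrBrDr => h; have h2 := le_lt_trans (lerD (lexx _) (fK x)) h.
by have := le_lt_trans (ler_normD _ _) h2; rewrite subrK ltxx.
Qed.

End bounded_operators.

(** * Tensor products and the partial transpose *)

Section tensor_theory.
Variables (R : realType) (HA HB : hilbertType R) (T : tensorProduct HA HB).
Local Notation C := R[i].

Lemma norm_tens a b : `|tens T a b| = `|a| * `|b|.
Proof.
apply/eqP; rewrite -(@eqrXn2 _ 2)// ?mulr_ge0//.
by rewrite exprMn -!dotpp dotp_tens.
Qed.

Lemma tensDl u v w : tens T (u + v) w = tens T u w + tens T v w.
Proof. by rewrite -[u]scale1r tensPl !scale1r. Qed.

Lemma tens0l w : tens T 0 w = 0.
Proof. by apply: (addrI (tens T 0 w)); rewrite -tensDl !addr0. Qed.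

Lemma tensZl a u w : tens T (a *: u) w = a *: tens T u w.
Proof. by rewrite -[a *: u]addr0 tensPl tens0l addr0. Qed.

Lemma slice_ex b (z : T) : exists r, forall a, dotp a r = dotp (tens T a b) z.
Proof.
have [||r rE] := @riesz _ _ (fun a => dotp z (tens T a b)) (`|z| * `|b|).
- by move=> a u v; rewrite tensPl dotpP.
- move=> u; rewrite (le_trans (cauchy_schwarz _ _))// norm_tens.
  by rewrite (mulrC (Num.norm u)) mulrA.
- by exists r => a; rewrite dotpC rE -dotpC.
Qed.

(** The partial inner product $(1\otimes\langle b|)z$; Riesz representation supplies it without a
    basis of [HA]. *)
Definition slice b (z : T) : HA := projT1 (cid (slice_ex b z)).

Lemma dotp_slice a b (z : T) : dotp a (slice b z) = dotp (tens T a b) z.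
Proof. by rewrite /slice; case: cid. Qed.

Lemma slice_linear b a (u v : T) : slice b (a *: u + v) = a *: slice b u + slice b v.
Proof. by apply: dotp_inj => x; rewrite dotpP !dotp_slice dotpP. Qed.

Lemma slice_tens b a b' : slice b (tens T a b') = dotp b b' *: a.
Proof. by apply: dotp_inj => x; rewrite dotp_slice dotp_tens dotpZr mulrC. Qed.

Variables (I : choiceType) (e : I -> HB).

(** The vector [w] is the orthogonal projection of [v] onto
    $H_A\otimes\operatorname{span}(e_i)_{i\in s}$, so $\langle w,v\rangle=\|w\|^2$ and
    $\|v-w\|^2\ge0$ concludes. *)
Lemma slice_bessel (s : seq I) (v : T) : orthonormal_family e -> uniq s ->
  \sum_(i <- s) `|slice (e i) v| ^+ 2 <= `|v| ^+ 2.
Proof.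
move=> oe us; pose w := \sum_(i <- s) tens T (slice (e i) v) (e i).
pose S := \sum_(i <- s) `|slice (e i) v| ^+ 2.
have wvE : dotp w v = S.
  by rewrite /w dotp_suml; apply: eq_bigr => i _; rewrite -dotp_slice dotpp.
have SR : S^* = S by apply/conj_Creal/ger0_real/sumr_ge0 => i _; rewrite exprn_ge0.
have wwE : dotp w w = S.
  rewrite {1}/w dotp_suml /S big_seq [RHS]big_seq; apply: eq_bigr => i si.
  rewrite dotp_sumr (bigD1_seq i)//= dotp_tens oe eqxx mulr1 dotpp big1 ?addr0//.
  by move=> j ji; rewrite dotp_tens oe eq_sym (negbTE ji) mulr0.
have := dotp_ge0 (v - w); rewrite dotpBl !dotpBr wwE wvE (dotpC v w) wvE SR.
by rewrite subrr subr0 subr_ge0 dotpp.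
Qed.

Hypothesis onb_e : onb e.

(** For fixed [a] the Riesz vector of $b\mapsto\langle z,a\otimes b\rangle$ is orthogonal to every
    [e i], hence zero. So [z] is orthogonal to a dense subspace, and an element of it closer to [z]
    than $\|z\|$ would contradict $z\ne0$. *)
Lemma tens_total (z : T) : (forall a i, dotp (tens T a (e i)) z = 0) -> z = 0.
Proof.
move=> z0.
have zt a b : dotp z (tens T a b) = 0.
  have [||r rE] := @riesz _ _ (fun b => dotp z (tens T a b)) (`|z| * `|a|).
  - by move=> c u v; rewrite tensPr dotpP.
  - by move=> u; rewrite (le_trans (cauchy_schwarz _ _))// norm_tens mulrA.
  have r0 : r = 0.
    by apply: onb_e.2 => i; rewrite dotpC rE -dotpC z0.
  by rewrite -rE r0 dotp0l.
apply/eqP; apply: contraT => zn0.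
have nz : 0 < `|z| by rewrite normr_gt0.
have [||w []] := @tens_dense _ _ _ T (ball z `|z|).
- by exists z; exact: ballxx.
- by apply: ball_open.
rewrite -ball_normE /= => zw [n [u [v wE]]].
have zw0 : dotp z w = 0 by rewrite wE dotp_sumr big1.
have : dotp z z = dotp z (z - w) by rewrite dotpBr zw0 subr0.
rewrite dotpp => E.
have : `|z| ^+ 2 <= `|z| * `|z - w|.
  by rewrite -[X in X <= _]ger0_norm ?exprn_ge0// E cauchy_schwarz.
by rewrite expr2 ler_pM2l// => /le_lt_trans/(_ zw); rewrite ltxx.
Qed.

Lemma matrix_elements_inj (Y Z : T -> T) : bounded_linear Y -> bounded_linear Z ->
  (forall a a' i j, dotp (tens T a (e i)) (Y (tens T a' (e j))) =
    dotp (tens T a (e i)) (Z (tens T a' (e j)))) -> Y = Z.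
Proof.
move=> bY bZ YZ.
pose D := -1 *: Z + Y.
have bD : bounded_linear D by exact: bounded_linearPZ.
have D0 a' j : D (tens T a' (e j)) = 0.
  by apply: tens_total => a i; rewrite /D fctE dotpP YZ mulN1r addNr.
apply/funext => v; apply: dotp_inj => w; apply/eqP; rewrite -subr_eq0; apply/eqP.
(* Here [r] is $D^*w$, which is orthogonal to all $a\otimes e_i$ because [D] kills them. *)
have [r rE] := adjoint_ex bD w.
have r0 : r = 0.
  by apply: tens_total => a i; rewrite dotpC rE D0 dotp0r conjC0.
by have := rE v; rewrite r0 dotp0l /D fctE dotpP mulN1r addrC => <-.
Qed.

Lemma ptranspose_eq (X Y : T -> T) : bounded_linear Y ->
  (forall a a' i j, dotp (tens T a (e i)) (Y (tens T a' (e j))) =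
    dotp (tens T a (e j)) (X (tens T a' (e i)))) -> ptranspose e X = Y.
Proof.
move=> bY YX; rewrite /ptranspose; case: xgetP => [Z _ [bZ ZX]|/(_ Y)]; last by case.
by apply: matrix_elements_inj => // a a' i j; rewrite ZX YX.
Qed.

End tensor_theory.

(** Enclosing a finite set of pairs in a rectangle lets the two indices be summed one after the
    other. *)
Lemma ler_sum_rectangle (I J : eqType) (F : numDomainType) (s : seq (I * J))
    (h : I -> J -> F) : uniq s -> (forall i j, 0 <= h i j) ->
  \sum_(p <- s) h p.1 p.2 <=
  \sum_(i <- undup [seq p.1 | p <- s]) \sum_(j <- undup [seq p.2 | p <- s]) h i j.
Proof.
move=> us h0; pose t := [seq (i, j) | i <- undup [seq p.1 | p <- s],
                                      j <- undup [seq p.2 | p <- s]].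
have ut : uniq t by apply: allpairs_uniq; rewrite ?undup_uniq//; move=> [? ?] [? ?] _ _ /=.
have st : {subset s <= t}.
  move=> [i j] sij; apply/allpairsP; exists (i, j) => /=.
  by rewrite !mem_undup; split=> //; apply/mapP; exists (i, j).
apply: le_trans (ler_sum_subset us st _) _ => //.
by rewrite undup_id// /t big_allpairs_dep.
Qed.

(** * Existence of the partial transpose *)

Section ptranspose_existence.
Variables (R : realType) (HA HB : hilbertType R) (T : tensorProduct HA HB).
Local Notation C := R[i].
Variables (I : choiceType) (e : I -> HB).
Hypothesis onb_e : onb e.

Section trace_class_psd.
Variables (X : T -> T) (c : C).
Hypothesis psdX : psd X.
Hypothesis Xc : forall n (u v : 'I_n -> T),
    orthonormal_family u -> orthonormal_family v ->
    \sum_(k < n) `|dotp (u k) (X (v k))| <= c.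

Let q z := dotp z (X z).

Let q_ge0 z : 0 <= q z. Proof. exact: psdX.2. Qed.

Let c_ge0 : 0 <= c.
Proof.
have v0 (i : 'I_0) : T by case: i.
by have := Xc (u := v0) (v := v0); rewrite big_ord0; apply; case.
Qed.

(** After normalising [a], the vectors $a\otimes e_i$ are orthonormal, and the trace norm bound
    applies with both families equal to them. *)
Let sum_q_tens a (s : seq I) : uniq s ->
  \sum_(i <- s) q (tens T a (e i)) <= c * `|a| ^+ 2.
Proof.
move=> us; have [->|a0] := eqVneq a 0.
  rewrite normr0 expr0n mulr0 big1// => i _.
  by rewrite tens0l /q dotp0l.
have na : `|a| != 0 by rewrite normr_eq0.
pose b := `|a|^-1 *: a.
have nb : dotp b b = 1.
  by rewrite dotpp /b normrZ normfV normr_id mulVf// expr1n.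
have aE : a = `|a| *: b by rewrite /b scalerA divff// scale1r.
have qE i : q (tens T a (e i)) = `|a| ^+ 2 * q (tens T b (e i)).
  rewrite {1}aE tensZl /q (linear_opZ (psd_lin psdX)) dotpZl dotpZr mulrA.
  by rewrite conj_Creal ?normr_real.
under eq_bigr do rewrite qE; rewrite -mulr_sumr mulrC ler_wpM2r ?exprn_ge0//.
pose u (k : 'I_(size s)) : T := tens T b (e (tnth (in_tuple s) k)).
have ou : orthonormal_family u.
  have /tuple_uniqP uinj : uniq (in_tuple s) by [].
  by move=> k l; rewrite /u dotp_tens nb mul1r onb_e.1 (inj_eq uinj).
apply: le_trans (Xc ou ou).
rewrite big_tnth; apply: ler_sum => k _.
by rewrite /u -/(q _) ger0_norm.
Qed.

(** The trace bound handles the second index, Bessel for slices the first. *)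
Let sum_q_slices (v : T) (s : seq (I * I)) : uniq s ->
  \sum_(p <- s) q (tens T (slice (e p.1) v) (e p.2)) <= c * `|v| ^+ 2.
Proof.
move=> us.
apply: le_trans (ler_sum_rectangle (h := fun i j => q (tens T (slice (e i) v) (e j))) us _) _ => //.
apply: (@le_trans _ _ (\sum_(i <- undup [seq p.1 | p <- s]) c * `|slice (e i) v| ^+ 2)).
  by apply: ler_sum => i _; apply: sum_q_tens; exact: undup_uniq.
rewrite -mulr_sumr ler_wpM2l// slice_bessel ?undup_uniq//; exact: onb_e.1.
Qed.

(** For $p=(i,j)$ this is $(1\otimes|i\rangle\langle j|)X(1\otimes|i\rangle\langle j|)v$. *)
Let term (v : T) (p : I * I) : T :=
  tens T (slice (e p.2) (X (tens T (slice (e p.2) v) (e p.1)))) (e p.1).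

Let g (v : T) (p : I * I) : C := q (tens T (slice (e p.2) v) (e p.1)).

Let g_sum_ge0 v (P : {fset I * I}) : 0 <= \sum_(p <- P) g v p.
Proof. by apply: sumr_ge0 => p _; exact: q_ge0. Qed.

Let sum_g v (P : {fset I * I}) : \sum_(p <- P) g v p <= c * `|v| ^+ 2.
Proof.
pose s := [seq (p.2, p.1) | p <- P].
have us : uniq s by rewrite map_inj_uniq ?fset_uniq// => -[? ?] [? ?] [-> ->].
by have := sum_q_slices v us; rewrite big_map.
Qed.

(** Pair the block [w] with itself: Cauchy-Schwarz gives $\|w\|^4\le c\|w\|^2\sum g$, since the
    slices of [w] obey the same bound as those of [v]; then $\|w\|^2$ cancels. *)
Let sum_term v (P : {fset I * I}) :
  `|\sum_(p <- P) term v p| ^+ 2 <= c * \sum_(p <- P) g v p.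
Proof.
set w := \sum_(p <- P) term v p.
have wE : dotp w w = \sum_(p <- P)
    dotp (tens T (slice (e p.1) w) (e p.2)) (X (tens T (slice (e p.2) v) (e p.1))).
  rewrite {2}/w dotp_sumr; apply: eq_bigr => p _.
  by rewrite /term -[RHS]dotp_slice dotpC -dotp_slice -dotpC.
have := psd_sum_cauchy_schwarz P (fun p => tens T (slice (e p.1) w) (e p.2))
  (fun p => tens T (slice (e p.2) v) (e p.1)) psdX.
rewrite -wE dotpp normrX normr_id -exprM => h.
have [->|w0] := eqVneq w 0; first by rewrite normr0 expr0n/= mulr_ge0// g_sum_ge0.
rewrite -(ler_pM2l (_ : 0 < `|w| ^+ 2)) ?exprn_gt0 ?normr_gt0// -exprD.
apply: le_trans h _; rewrite mulrA ler_wpM2r ?g_sum_ge0//.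
by rewrite mulrC sum_q_slices// fset_uniq.
Qed.

Let cvg_term v : cvg (partial_sum (term v) @ totally).
Proof.
by apply: (cvg_dominated_sum c_ge0 _ (sum_term v) (sum_g v)) => p; exact: q_ge0.
Qed.

Lemma ptranspose_exists : exists Y : T -> T, bounded_linear Y /\
  forall a a' i j, dotp (tens T a (e i)) (Y (tens T a' (e j))) =
    dotp (tens T a (e j)) (X (tens T a' (e i))).
Proof.
have Xl := psd_lin psdX.
have psE v P : partial_sum (term v) P = \sum_(p <- P) term v p.
  by rewrite /partial_sum big_seq_fsetE.
pose Y v : T := lim (partial_sum (term v) @ totally).
have Yd w v : (fun P => dotp w (partial_sum (term v) P) : C^o) @ totally --> (dotp w (Y v) : C^o).
  by apply: dotp_cvgr; exact: cvg_term.
have termP a u v p : term (a *: u + v) p = a *: term u p + term v p.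
  by rewrite /term slice_linear tensPl Xl slice_linear tensPl.
exists Y; split; first split.
- move=> a u v; apply: dotp_inj => w; rewrite dotpP.
  apply: scalar_cvg_unique (Yd w _) _.
  rewrite (_ : (fun P => _) = (fun P => a * dotp w (partial_sum (term u) P) +
      dotp w (partial_sum (term v) P))).
    exact: (@cvgD _ C^o _ _ _ _ _ _ _ (@cvgZr _ C^o _ _ _ _ _ _ (Yd w u)) (Yd w v)).
  apply/funext => P; rewrite !psE -dotpP; congr dotp.
  by rewrite scaler_sumr -big_split; apply: eq_bigr => p _; rewrite termP.
(* Testing the weak limit on [Y v] itself turns the bound on partial sums into a bound on the norm;
   [sum_term] and [sum_g] each give a factor [c] in the square. *)
- exists c => v; have [->|Y0] := eqVneq (Y v) 0; first by rewrite normr0 mulr_ge0.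
  have nY : 0 < `|Y v| by rewrite normr_gt0.
  rewrite -(ler_pM2l nY) -expr2 -dotpp -[X in X <= _]ger0_norm ?dotp_ge0//.
  apply: scalar_cvg_norm_le (Yd (Y v) v) _; first by rewrite !mulr_ge0.
  move=> P; apply: le_trans (cauchy_schwarz _ _) _; rewrite ler_wpM2l// psE.
  rewrite -(@ler_pXn2r _ 2)// ?nnegrE ?mulr_ge0//.
  apply: le_trans (sum_term _ _) _.
  by rewrite exprMn expr2 -mulrA ler_wpM2l// sum_g.
- move=> a a' k l; apply: scalar_cvg_unique (Yd _ _) _.
  (* Only the summand $(k,l)$ has a nonzero matrix element here, so the net is constant once it
     contains that pair. *)
  apply/cvgrPdist_lt => d d0; exists [fset (k, l)]%fset => // P /= klP.
  have kl : (k, l) \in P by apply: (fsubsetP klP); rewrite inE.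
  rewrite psE dotp_sumr (bigD1_seq (k, l))//= ?fset_uniq// big1 => [|[i j] ij].
    by rewrite addr0 /term /= slice_tens !dotp_tens !onb_e.1 !eqxx mulr1 scale1r dotp_slice subrr normr0.
  rewrite /term /= slice_tens !dotp_tens !onb_e.1.
  have [jl|jl] := eqVneq j l; last first.
    by rewrite scale0r tens0l linear_op0// dotp_slice dotp0r mul0r.
  have [ki|ki] := eqVneq k i; last by rewrite mulr0.
  by move: ij; rewrite jl -ki eqxx.
Qed.

End trace_class_psd.

Lemma ptransposeP (X : T -> T) : psd X -> trace_class X ->
  bounded_linear (ptranspose e X) /\
  forall a a' i j, dotp (tens T a (e i)) (ptranspose e X (tens T a' (e j))) =
    dotp (tens T a (e j)) (X (tens T a' (e i))).
Proof.
move=> psdX [_ [c Xc]]; have [Y [bY YX]] := ptranspose_exists psdX Xc.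
by rewrite (ptranspose_eq onb_e bY YX).
Qed.

(** Positivity of both operands keeps [ptranspose] away from its default; the coefficients are
    arbitrary, so the combination may be indefinite. *)
Lemma ptransposeD (X Y : T -> T) (a b : C) :
  psd X -> trace_class X -> psd Y -> trace_class Y ->
  ptranspose e (a *: X + b *: Y) = a *: ptranspose e X + b *: ptranspose e Y.
Proof.
move=> pX tX pY tY.
have [bX XE] := ptransposeP pX tX; have [bY YE] := ptransposeP pY tY.
apply: ptranspose_eq => //.
  apply: bounded_linearPZ => //; rewrite -[b *: _]addr0.
  by apply: bounded_linearPZ => //; exact: bounded_linear0.
by move=> u u' i j; rewrite !fctE !dotpP !dotpZr XE YE.
Qed.

End ptranspose_existence.

(** * Traces and finite dimension *)

Section traces.
Variables (R : realType) (H : hilbertType R).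
Local Notation C := R[i].
Implicit Types (X Y : H -> H) (a : C).

Lemma onb_coord_sum (I : eqType) (e : I -> H) (P : seq I) (f : I -> C) k :
  orthonormal_family e -> uniq P ->
  dotp (e k) (\sum_(i <- P) f i *: e i) = if k \in P then f k else 0.
Proof.
move=> oe uP; rewrite dotp_sumr; case: ifP => kP.
  rewrite (bigD1_seq k)//= dotpZr oe eqxx mulr1 big1 ?addr0// => i ik.
  by rewrite dotpZr oe eq_sym (negbTE ik) mulr0.
rewrite big_seq big1// => i iP; rewrite dotpZr oe.
by case: eqP iP => [<-|]; rewrite ?kP ?mulr0.
Qed.

Lemma norm_onb_sum (I : eqType) (e : I -> H) (P : seq I) (f : I -> C) :
  orthonormal_family e -> uniq P ->
  `|\sum_(i <- P) f i *: e i| ^+ 2 = \sum_(i <- P) `|f i| ^+ 2.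
Proof.
move=> oe uP; rewrite -dotpp dotp_suml big_seq [RHS]big_seq; apply: eq_bigr => i iP.
by rewrite dotpZl onb_coord_sum// iP mulrC normCK.
Qed.

Lemma bessel (I : eqType) (e : I -> H) (P : seq I) v :
  orthonormal_family e -> uniq P -> \sum_(i <- P) `|dotp (e i) v| ^+ 2 <= `|v| ^+ 2.
Proof.
move=> oe uP; pose w := \sum_(i <- P) dotp (e i) v *: e i.
pose S := \sum_(i <- P) `|dotp (e i) v| ^+ 2.
have wwE : dotp w w = S by rewrite dotpp norm_onb_sum.
have wvE : dotp w v = S.
  by rewrite dotp_suml; apply: eq_bigr => i _; rewrite dotpZl mulrC normCK.
have SR : S^* = S by apply/conj_Creal/ger0_real/sumr_ge0 => i _; rewrite exprn_ge0.
have := dotp_ge0 (v - w); rewrite dotpBl !dotpBr wwE wvE (dotpC v w) wvE SR.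
by rewrite subrr subr0 subr_ge0 dotpp.
Qed.

(** Bessel makes the Fourier series of [v] converge; its limit has the coefficients of [v], so
    totality of the basis identifies the two. *)
Lemma parseval (I : choiceType) (e : I -> H) u v : onb e ->
  partial_sum (fun i => dotp u (e i) * dotp (e i) v : C^o) @ totally -->
  (dotp u v : C^o).
Proof.
move=> [oe e0].
pose t i := dotp (e i) v *: e i.
have /cvg_ex[z tz] : cvg (partial_sum t @ totally).
  apply: (@cvg_dominated_sum _ _ _ _ (fun i => `|dotp (e i) v| ^+ 2) 1 (`|v| ^+ 2)) => //.
  - by move=> P; rewrite mul1r norm_onb_sum ?fset_uniq.
  - by move=> P; rewrite bessel ?fset_uniq.
have psE P : partial_sum t P = \sum_(i <- P) t i by rewrite /partial_sum big_seq_fsetE.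
have zv : z = v.
  apply/eqP; rewrite -subr_eq0; apply/eqP/e0 => k; rewrite dotpBr.
  apply/eqP; rewrite subr_eq0; apply/eqP.
  apply: (@scalar_cvg_unique _ _ totally _ (fun P => dotp (e k) (partial_sum t P))).
    exact: dotp_cvgr.
  apply/cvgrPdist_lt => d d0; exists [fset k]%fset => // P /= kP.
  have kinP : k \in P by apply: (fsubsetP kP); rewrite inE.
  by rewrite psE onb_coord_sum ?fset_uniq// kinP subrr normr0.
have := @dotp_cvgr _ _ _ totally _ _ _ u tz.
rewrite (_ : (fun P => _) = partial_sum (fun i => dotp u (e i) * dotp (e i) v : C^o)).
  by rewrite zv; exact.
apply/funext => P; rewrite psE /partial_sum dotp_sumr big_seq_fsetE.
by apply: eq_bigr => i _; rewrite dotpZr mulrC.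
Qed.

Lemma trace_classPZ a X Y : trace_class X -> trace_class Y -> trace_class (a *: X + Y).
Proof.
move=> [bX [c Xc]] [bY [d Yd]]; split; first exact: bounded_linearPZ.
exists (`|a| * c + d) => n u v ou ov.
apply: le_trans (lerD (ler_wpM2l (normr_ge0 a) (Xc _ _ _ ou ov)) (Yd _ _ _ ou ov)).
rewrite mulr_sumr -big_split; apply: ler_sum => k _ /=.
by rewrite !fctE dotpP (le_trans (ler_normD _ _))// normrM.
Qed.

Lemma trace_class0 : trace_class (0 : H -> H).
Proof.
split; first exact: bounded_linear0.
by exists 0 => n u v _ _; rewrite big1// => k _; rewrite dotp0r normr0.
Qed.

Lemma trace_classZ a X : trace_class X -> trace_class (a *: X).
Proof. by move=> tX; rewrite -[_ *: _]addr0; apply: trace_classPZ => //; exact: trace_class0. Qed.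

Lemma has_tracePZ a X Y s t : has_trace X s -> has_trace Y t ->
  has_trace (a *: X + Y) (a * s + t).
Proof.
move=> [tX Xs] [tY Yt]; split=> [|I e oe]; first exact: trace_classPZ.
rewrite (_ : partial_sum _ = (fun P => a * partial_sum (fun i => dotp (e i) (X (e i))) P
  + partial_sum (fun i => dotp (e i) (Y (e i))) P)).
  exact: (@cvgD _ C^o _ _ _ _ _ _ _ (@cvgZr _ C^o _ _ _ _ _ _ (Xs I e oe)) (Yt I e oe)).
apply/funext => P; rewrite /partial_sum mulr_sumr -big_split; apply: eq_bigr => i _ /=.
by rewrite fctE dotpP.
Qed.

Lemma has_trace0 : has_trace (0 : H -> H) 0.
Proof.
split=> [|I e oe]; first exact: trace_class0.
rewrite (_ : partial_sum _ = cst 0); first exact: cvg_cst.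
by apply/funext => P; rewrite /partial_sum big1// => i _; rewrite dotp0r.
Qed.

Lemma has_traceZ a X s : has_trace X s -> has_trace (a *: X) (a * s).
Proof.
by move=> Xs; have := has_tracePZ a Xs has_trace0; rewrite !addr0.
Qed.

End traces.

Lemma scalar_cvg_sum (R : realType) (T : Type) (F : set_system T) (FF : Filter F)
    (J : Type) (r : seq J) (f : J -> T -> R[i]) (l : J -> R[i]) :
  (forall j, (fun x => f j x : R[i]^o) @ F --> (l j : R[i]^o)) ->
  (fun x => \sum_(j <- r) f j x : R[i]^o) @ F --> (\sum_(j <- r) l j : R[i]^o).
Proof.
move=> fl; elim: r => [|j r IH].
  rewrite big_nil (_ : (fun x => _) = cst 0); first exact: cvg_cst.
  by apply/funext => x; rewrite big_nil.
rewrite big_cons (_ : (fun x => _) = fun x => f j x + \sum_(j <- r) f j x).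
  exact: (@cvgD _ R[i]^o _ _ _ _ _ _ _ (fl j) IH).
by apply/funext => x; rewrite big_cons.
Qed.

Lemma mulr_le_sum_sqr (F : numDomainType) (x y : F) :
  0 <= x -> 0 <= y -> x * y <= x ^+ 2 + y ^+ 2.
Proof.
move=> x0 y0; have [xy|/ltW yx] := real_leP (ger0_real x0) (ger0_real y0).
  by rewrite (@le_trans _ _ (y ^+ 2))// ?ler_wpM2r// lerDr exprn_ge0.
by rewrite (@le_trans _ _ (x ^+ 2))// ?ler_wpM2l// lerDl exprn_ge0.
Qed.

Section euclid_theory.
Variables (R : realType) (J : finType).
Local Notation C := R[i].
Local Notation E := (euclid R J).
Local Notation ket := (@ket R J).

Lemma dotp_ket j (v : E) : dotp (ket j) v = v j.
Proof.
rewrite dotp_euclidE (bigD1 j)//= ffunE eqxx conjC1 mul1r big1 ?addr0// => k kj.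
by rewrite ffunE (negbTE kj) conjC0 mul0r.
Qed.

Lemma ket_expand (v : E) : v = \sum_j v j *: ket j.
Proof.
apply/ffunP => k; rewrite sum_ffunE (bigD1 k)//= big1 => [|j jk].
  by rewrite !ffunE eqxx addr0 /GRing.scale /= mulr1.
by rewrite !ffunE eq_sym (negbTE jk) /GRing.scale /= mulr0.
Qed.

Lemma norm_ket j : `|ket j| = 1.
Proof.
by apply/eqP; rewrite -(@eqrXn2 _ 2)// expr1n -dotpp dotp_ket ffunE eqxx.
Qed.

Lemma euclid_bounded (X : E -> E) : linear X -> bounded_linear X.
Proof.
move=> Xl; split=> //; exists (\sum_j `|X (ket j)|) => v.
rewrite [v in X v]ket_expand linear_op_sum// (le_trans (ler_norm_sum _ _ _))//.
rewrite mulr_suml ler_sum// => j _; rewrite linear_opZ// normrZ mulrC ler_wpM2l//.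
by rewrite -dotp_ket (le_trans (cauchy_schwarz _ _))// norm_ket mul1r.
Qed.

(** Expand each [v k] in the [ket] basis, bound products by sums of squares and apply Bessel to both
    families: index [j] contributes at most $\|X|j\rangle\|^2+1$, whatever the families. *)
Lemma euclid_trace_class (X : E -> E) : linear X -> trace_class X.
Proof.
move=> Xl; split; first exact: euclid_bounded.
exists (\sum_j (`|X (ket j)| ^+ 2 + 1)) => n u v ou ov.
have ub (w : 'I_n -> E) (x : E) : orthonormal_family w ->
    \sum_(k < n) `|dotp (w k) x| ^+ 2 <= `|x| ^+ 2.
  by move=> ow; apply: bessel ow (index_enum_uniq _).
apply: (@le_trans _ _ (\sum_(k < n) \sum_j (`|dotp (u k) (X (ket j))| ^+ 2 + `|dotp (v k) (ket j)| ^+ 2))).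
  apply: ler_sum => k _; rewrite {1}[v k]ket_expand linear_op_sum// dotp_sumr.
  apply: le_trans (ler_norm_sum _ _ _) _; apply: ler_sum => j _.
  rewrite linear_opZ// dotpZr -dotp_ket dotpC normrM norm_conjC.
  by rewrite mulrC mulr_le_sum_sqr.
rewrite exchange_big; apply: ler_sum => j _ /=; rewrite big_split lerD ?ub//.
by rewrite (le_trans (ub _ _ ov))// norm_ket expr1n.
Qed.

(** The bases allowed are indexed by any choice type, so basis independence is a limit statement:
    Parseval for each [ket j], then a finite sum over [j]. *)
Lemma euclid_has_trace (X : E -> E) : linear X ->
  has_trace X (\sum_j dotp (ket j) (X (ket j))).
Proof.
move=> Xl; split=> [|I e oe]; first exact: euclid_trace_class.
rewrite (_ : partial_sum _ = fun P => \sum_j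
    partial_sum (fun i => dotp (ket j) (e i) * dotp (e i) (X (ket j)) : C^o) P).
  by apply: scalar_cvg_sum => j; exact: parseval.
apply/funext => P; rewrite /partial_sum [RHS]exchange_big; apply: eq_bigr => i _ /=.
rewrite {2}[e (val i)]ket_expand linear_op_sum// dotp_sumr; apply: eq_bigr => j _.
by rewrite linear_opZ// dotpZr dotp_ket.
Qed.

Lemma euclid_traceE (X : E -> E) t : has_trace X t -> t = \sum_j dotp (ket j) (X (ket j)).
Proof.
move=> Xt; have [_ h] := Xt.
have [_ h'] := euclid_has_trace Xt.1.1.1.
apply: (@scalar_cvg_unique R _ totally _
  (partial_sum (fun j => dotp (ket j) (X (ket j)) : C^o))).
  exact: h (onb_ket R J).
exact: h' (onb_ket R J).
Qed.

End euclid_theory.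

Section euclid_ptranspose.
Variables (R : realType) (J K : finType).
Local Notation C := R[i].
Local Notation E := (euclid_tensor R J K).

Lemma euclid_tensE (u : euclid R J) (v : euclid R K) p :
  tens E u v p = u p.1 * v p.2.
Proof. by rewrite /tens /= ffunE. Qed.

Lemma ket_pair j k : @ket R (J * K)%type (j, k) = tens E (ket j) (ket k).
Proof.
apply/ffunP => -[j' k']; rewrite euclid_tensE !ffunE -natrM mulnb.
by rewrite -pair_eqE.
Qed.

Lemma dotp_tens_ket a i (w : E) :
  dotp (tens E a (ket i)) w = \sum_k (a k)^* * w (k, i).
Proof.
rewrite dotp_euclidE.
transitivity (\sum_k \sum_l (tens E a (ket i) (k, l))^* * w (k, l)).
  by rewrite pair_bigA; apply: eq_bigr => -[].
apply: eq_bigr => k _; rewrite (bigD1 i)//= big1 ?addr0.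
  by rewrite euclid_tensE ffunE eqxx mulr1.
by move=> l /negbTE li; rewrite euclid_tensE ffunE li mulr0 conjC0 mul0r.
Qed.

Lemma tens_ket_expand a i : tens E a (ket i) = \sum_k a k *: ket (k, i).
Proof.
rewrite [a in LHS]ket_expand.
have := @big_morph _ _ (fun u => tens E u (ket i)) _ _ _ _ (fun u v => tensDl E u v (ket i)) (tens0l E (ket i)).
by move=> ->; apply: eq_bigr => k _; rewrite tensZl ket_pair.
Qed.

Lemma euclid_ptransposeP (X : E -> E) : linear X ->
  linear (ptranspose (@ket R K) X) /\
  forall a a' i j, dotp (tens E a (ket i)) (ptranspose (@ket R K) X (tens E a' (ket j))) =
    dotp (tens E a (ket j)) (X (tens E a' (ket i))).
Proof.
move=> Xl.
(* The entry of [Y] at row $(p_1,p_2)$ and column $(q_1,q_2)$ is that of [X] with $p_2$ and $q_2$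
   exchanged. *)
pose Y (v : E) : E := [ffun p => \sum_(q : J * K) X (ket (q.1, p.2)) (p.1, q.2) * v q].
have Yl : linear Y.
  move=> a u v; apply/ffunP => p; rewrite !ffunE /GRing.scale /= mulr_sumr -big_split.
  by apply: eq_bigr => q _; rewrite !ffunE /GRing.scale /=; ring.
have YX a a' i j : dotp (tens E a (ket i)) (Y (tens E a' (ket j))) =
    dotp (tens E a (ket j)) (X (tens E a' (ket i))).
  rewrite !dotp_tens_ket; apply: eq_bigr => k _; congr (_ * _).
  rewrite ffunE; transitivity (\sum_q \sum_l X (ket (q, i)) (k, l) * (a' q * (l == j)%:R)).
    by rewrite pair_bigA; apply: eq_bigr => -[q l] _; rewrite euclid_tensE ffunE.
  rewrite tens_ket_expand linear_op_sum// sum_ffunE; apply: eq_bigr => q _.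
  rewrite (bigD1 j)//= eqxx mulr1 big1 ?addr0.
    by rewrite linear_opZ// ffunE mulrC.
  by move=> l /negbTE ->; rewrite !mulr0.
have bY : bounded_linear Y by exact: euclid_bounded.
by rewrite (ptranspose_eq (onb_ket R K) bY YX).
Qed.

End euclid_ptranspose.

(** * Channels *)

Section schur.
Variables (R : realType) (H : hilbertType R).
Local Notation C := R[i].

(** Diagonalise the hermitian matrix of these values and scale the rows of the diagonalising unitary
    by the square roots of the eigenvalues. *)
Lemma psd_gram (Z : H -> H) n (v : 'I_n -> H) : psd Z ->
  exists b : 'I_n -> 'I_n -> C, forall k l,
    dotp (v k) (Z (v l)) = \sum_r (b r k)^* * b r l.
Proof.
move=> pZ; have Zl := psd_lin pZ.
pose A : 'M[C]_n := \matrix_(k, l) dotp (v k) (Z (v l)).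
have /hermitian_normalmx/orthomx_spectralP : A \is hermsymmx.
  apply/is_hermitianmxP; rewrite expr0 scale1r; apply/matrixP => k l.
  by rewrite !mxE -psd_hermitian.
have /unitarymxP := spectral_unitarymx A; rewrite invmx_unitary ?spectral_unitarymx//.
set P := spectralmx A; set D := spectral_diag A => PP AE.
(* Each eigenvalue is a value of the quadratic form of [Z], hence nonnegative. *)
have DE r : D 0 r = dotp (\sum_k (P r k)^* *: v k) (Z (\sum_k (P r k)^* *: v k)).
  have : P *m A *m map_mx Num.conj P^T = diag_mx D.
    by rewrite AE !mulmxA PP mul1mx -mulmxA PP mulmx1.
  move=> /matrixP/(_ r r); rewrite !mxE eqxx mulr1n => <-.
  rewrite linear_op_sum// dotp_sumr; apply: eq_bigr => l _.
  rewrite linear_opZ// dotpZr !mxE mulrC; congr (_ * _).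
  by rewrite dotp_suml; apply: eq_bigr => k _; rewrite dotpZl conjCK mxE.
have D0 r : 0 <= D 0 r by rewrite DE pZ.2.
exists (fun r l => sqrtC (D 0 r) * P r l) => k l.
have := congr1 (fun M : 'M[C]_n => M k l) AE; rewrite mxE => ->.
rewrite mxE; apply: eq_bigr => r _.
have sR : (sqrtC (D 0 r))^* = sqrtC (D 0 r).
  by apply/conj_Creal/ger0_real; rewrite sqrtC_ge0.
rewrite mul_mx_diag !mxE conjCM sR; set s := sqrtC _.
by rewrite -(sqrtCK (D 0 r)) -/s; ring.
Qed.

(* A Gram decomposition of <v_k, Z v_l> reduces the Schur product to positivity
   of X on the families (b_rk psi)_k. *)
Lemma schur_product_ge0 (K : hilbertType R) n (X : 'I_n -> 'I_n -> K -> K)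
    (psi : K) (v : 'I_n -> H) (Z : H -> H) :
  (forall k l, linear (X k l)) -> block_psd X -> psd Z ->
  0 <= \sum_k \sum_l dotp psi (X k l psi) * dotp (v k) (Z (v l)).
Proof.
move=> Xl X0 pZ; have [b bE] := psd_gram v pZ.
rewrite (_ : \sum_k _ = \sum_r \sum_k \sum_l dotp (b r k *: psi) (X k l (b r l *: psi))).
  by apply: sumr_ge0 => r _; exact: X0.
rewrite [RHS]exchange_big; apply: eq_bigr => k _ /=.
rewrite [RHS]exchange_big; apply: eq_bigr => l _ /=.
rewrite bE mulr_sumr; apply: eq_bigr => r _.
by rewrite (linear_opZ (Xl k l)) dotpZr dotpZl; ring.
Qed.

(** With $M=\sum_p|\psi_p\rangle\langle\psi_p|$ this covers coefficients of the form
    $\operatorname{Tr}(MX)$. *)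
Lemma schur_sum_ge0 (K : hilbertType R) (J : finType) n
    (X : 'I_n -> 'I_n -> K -> K) (psi : J -> K) (v : 'I_n -> H) (Z : H -> H) :
  (forall k l, linear (X k l)) -> block_psd X -> psd Z ->
  0 <= \sum_k \sum_l (\sum_p dotp (psi p) (X k l (psi p))) * dotp (v k) (Z (v l)).
Proof.
move=> Xl X0 pZ.
rewrite (_ : \sum_k _ =
  \sum_p \sum_k \sum_l dotp (psi p) (X k l (psi p)) * dotp (v k) (Z (v l))).
  by apply: sumr_ge0 => p _; exact: schur_product_ge0.
rewrite [RHS]exchange_big; apply: eq_bigr => k _ /=.
rewrite [RHS]exchange_big; apply: eq_bigr => l _ /=.
by rewrite mulr_suml.
Qed.

Lemma block_psd1 (X : H -> H) :
  block_psd (fun _ _ : 'I_1 => X) <-> forall v, 0 <= dotp v (X v).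
Proof.
split=> [h v|h v]; last by rewrite !big_ord1.
by have := h (fun=> v); rewrite !big_ord1.
Qed.

Lemma rank_one_linear (a : C) (g : H) : linear (fun v : H => a *: (dotp g v *: g)).
Proof.
move=> b u v; rewrite dotpP scalerDl scalerDr !scalerA.
by congr (_ *: _ + _); ring.
Qed.

Lemma linear_id_plus (a : C) (X : H -> H) : linear X -> linear (fun v : H => v + a *: X v).
Proof.
move=> Xl b u v; rewrite Xl !scalerDr !scalerA addrACA.
by rewrite (mulrC a b).
Qed.

Lemma dotp_rank_one (a : C) (g u v : H) :
  dotp u (a *: (dotp g v *: g)) = a * dotp g v * (dotp g u)^*.
Proof. by rewrite !dotpZr mulrA -dotpC. Qed.

Lemma dotp_add_scale (X : H -> H) (s : C) (u w : H) : linear X -> s^* = s -> s ^+ 2 = 1 ->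
  dotp (u + s *: w) (X (u + s *: w)) =
  dotp u (X u) + dotp w (X w) + s * (dotp w (X u) + dotp u (X w)).
Proof.
move=> Xl sR s1; have ss x : s * (s * x) = x by rewrite mulrA -expr2 s1 mul1r.
by rewrite (linear_opD Xl) (linear_opZ Xl) !(dotpDl, dotpDr, dotpZl, dotpZr) sR ss; ring.
Qed.

Lemma dotp_sub_rank_one (X : H -> H) (y : C) (u g : H) : linear X -> y^* = y ->
  dotp (u - y *: (dotp g u *: g)) (X (u - y *: (dotp g u *: g))) =
  dotp u (X u) - y * (dotp g u * dotp u (X g)) - y * ((dotp g u)^* * dotp g (X u))
  + y ^+ 2 * dotp g (X g) * ((dotp g u)^* * dotp g u).
Proof.
move=> Xl yR; rewrite -scaleNr (linear_opD Xl) !(linear_opZ Xl).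
by rewrite !(dotpDl, dotpDr, dotpZl, dotpZr) conjCN yR; ring.
Qed.

(** Since $(1+sF)^2=2(1+sF)$, twice the value is $\|(1+sF)v\|^2$. *)
Lemma involution_ge0 (F : H -> H) (s : C) v :
  (forall u w, dotp u (F w) = dotp (F u) w) -> involutive F ->
  s^* = s -> s ^+ 2 = 1 -> 0 <= dotp v (v + s *: F v).
Proof.
move=> Fs FK sR s1; have := dotp_ge0 (v + s *: F v).
rewrite -[X in _ -> is_true X](pmulrn_lge0 _ (isT : (0 < 2)%N)).
congr (is_true (0 <= _)); have ss x : s * (s * x) = x by rewrite mulrA -expr2 s1 mul1r.
by rewrite !(dotpDl, dotpDr, dotpZl, dotpZr) sR ss -!Fs FK; ring.
Qed.

End schur.

(** * The swap and the maximally entangled projector *)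

Section max_entangled_theory.
Variables (R : realType) (d : nat).
Local Notation C := R[i].
Local Notation Q := (qudits R d).
Local Notation ket := (@ket R _).

(** Left unnormalised, so that no square root of $d$ appears in $\Phi=d^{-1}|ghz\rangle\langle
    ghz|$. *)
Definition ghz : Q := \sum_i tens Q (ket i) (ket i).

Definition swap (v : Q) : Q := [ffun p => v (p.2, p.1)].

Lemma max_entangledE :
  @max_entangled R d = fun v : Q => d%:R^-1 *: (dotp ghz v *: ghz).
Proof.
apply/funext => v; rewrite /max_entangled /ghz dotp_suml; congr (_ *: _).
rewrite scaler_sumr; apply: eq_bigr => i _.
by rewrite scaler_suml.
Qed.

Lemma max_entangled_linear : linear (@max_entangled R d).
Proof. by rewrite max_entangledE; exact: rank_one_linear. Qed.

Lemma dotp_ghz_tens (a : euclid R 'I_d) (i : 'I_d) : dotp ghz (tens Q a (ket i)) = a i.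
Proof.
rewrite /ghz dotp_suml.
have E (j : 'I_d) : dotp (tens Q (ket j) (ket j)) (tens Q a (ket i)) = a j * (j == i)%:R.
  by rewrite dotp_tens !dotp_ket ffunE.
rewrite (eq_bigr _ (fun j _ => E j)) (bigD1 i)//= eqxx mulr1 big1 ?addr0//.
by move=> j /negbTE ->; rewrite mulr0.
Qed.

Lemma dotp_ghz_ket p : dotp ghz (ket p) = (p.1 == p.2)%:R.
Proof. by case: p => i j; rewrite ket_pair dotp_ghz_tens ffunE eq_sym. Qed.

Lemma dotp_ghz : dotp ghz ghz = d%:R.
Proof.
rewrite {2}/ghz dotp_sumr (eq_bigr (fun=> 1)).
  by rewrite sumr_const card_ord.
by move=> i _; rewrite dotp_ghz_tens ffunE eqxx.
Qed.

Lemma swap_linear : linear swap.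
Proof. by move=> a u v; apply/ffunP => p; rewrite !ffunE. Qed.

Lemma swapK : involutive swap.
Proof. by move=> v; apply/ffunP => -[i j]; rewrite !ffunE. Qed.

Let pswap (p : 'I_d * 'I_d) := (p.2, p.1).

Let pswap_bij : bijective pswap.
Proof. by exists pswap; case. Qed.

Lemma dotp_swap u v : dotp u (swap v) = dotp (swap u) v.
Proof.
rewrite !dotp_euclidE (reindex pswap (onW_bij _ pswap_bij)) /=.
by apply: eq_bigr => -[i j] _; rewrite !ffunE.
Qed.

Lemma swap_ket p : swap (ket p) = ket (pswap p).
Proof.
apply/ffunP => -[i j]; rewrite !ffunE /pswap /= -!pair_eqE /= andbC.
by case: p.
Qed.

Lemma dotp_tens_swap (a a' : euclid R 'I_d) (i j : 'I_d) :
  dotp (tens Q a (ket i)) (swap (tens Q a' (ket j))) = (a j)^* * a' i.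
Proof.
rewrite dotp_tens_ket (bigD1 j)//= ffunE euclid_tensE ffunE eqxx mulr1 big1 ?addr0//.
by move=> k kj; rewrite ffunE euclid_tensE ffunE (negbTE kj) !mulr0.
Qed.

Lemma ptranspose_swap (s : C) :
  ptranspose (fun i : 'I_d => ket i) (fun v : Q => v + s *: swap v) =
  (fun v => v + s *: (dotp ghz v *: ghz)).
Proof.
apply: ptranspose_eq; first exact: onb_ket.
  by apply: euclid_bounded; apply: linear_id_plus; have := rank_one_linear 1 ghz;
    under eq_fun do rewrite scale1r.
move=> a a' i j; rewrite !dotpDr !dotpZr dotp_tens_swap !dotp_tens.
rewrite dotp_ghz_tens (dotpC _ ghz) dotp_ghz_tens !dotp_ket !ffunE [i == j]eq_sym.
by rewrite [_^* * _]mulrC.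
Qed.

Lemma swap_ge0 (s : C) (v : Q) : s^* = s -> s ^+ 2 = 1 -> 0 <= dotp v (v + s *: swap v).
Proof. by apply: involution_ge0 => [u w|]; [exact: dotp_swap|exact: swapK]. Qed.

Definition ptr (X : Q -> Q) : C := \sum_p dotp (ket p) (X (ket p)).

(** This is $\operatorname{Tr}(FX)$ for the swap $F$, moved to the left argument by
    self-adjointness. *)
Definition swap_ptr (X : Q -> Q) : C := \sum_p dotp (swap (ket p)) (X (ket p)).

Lemma sum_dotp_ghz_sqr : \sum_p dotp ghz (ket p) ^+ 2 = d%:R :> C.
Proof.
have -> : d%:R = dotp ghz (\sum_p ghz p *: ket p) by rewrite -ket_expand dotp_ghz.
rewrite dotp_sumr; apply: eq_bigr => p _.
by rewrite dotpZr -dotp_ket [dotp (ket p) _]dotpC dotp_ghz_ket conjC_nat.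
Qed.

Lemma ptr_max_entangled : (0 < d)%N -> ptr (@max_entangled R d) = 1.
Proof.
move=> d0; have dn0 : d%:R != 0 :> C by rewrite pnatr_eq0 -lt0n.
rewrite -(mulVf dn0) -{2}sum_dotp_ghz_sqr mulr_sumr max_entangledE.
apply: eq_bigr => p _; rewrite dotp_rank_one -mulrA; congr (_ * _).
by rewrite dotp_ghz_ket conjC_nat.
Qed.

Lemma ghz_max_entangled : (0 < d)%N -> dotp ghz (max_entangled ghz) = d%:R.
Proof.
move=> d0; have dn0 : d%:R != 0 :> C by rewrite pnatr_eq0 -lt0n.
by rewrite max_entangledE dotp_rank_one dotp_ghz conjC_nat mulVf// mul1r.
Qed.

Lemma ptr_id : ptr id = (d ^ 2)%:R.
Proof.
rewrite /ptr (eq_bigr (fun=> 1)) => [|p _]; last by rewrite dotp_ket ffunE eqxx.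
by rewrite sumr_const card_prod card_ord.
Qed.

Lemma ptr_ptranspose X : linear X ->
  ptr (ptranspose (fun i : 'I_d => ket i) X) = ptr X.
Proof.
move=> Xl; have [_ XT] := euclid_ptransposeP Xl.
by apply: eq_bigr => -[i j] _; rewrite ket_pair; exact: XT.
Qed.

(** Partial transposition moves across the trace pairing and turns $|ghz\rangle\langle ghz|$ back
    into the swap. *)
Lemma ghz_ptranspose X : linear X ->
  dotp ghz (ptranspose (fun i : 'I_d => ket i) X ghz) = swap_ptr X.
Proof.
move=> Xl; have [Yl XT] := euclid_ptransposeP Xl.
rewrite {2}/ghz linear_op_sum// dotp_sumr.
transitivity (\sum_j \sum_i dotp (tens Q (ket i) (ket j)) (X (tens Q (ket j) (ket i)))).
  apply: eq_bigr => j _; rewrite /ghz dotp_suml; apply: eq_bigr => i _.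
  exact: XT.
rewrite pair_bigA; apply: eq_bigr => -[j i] _.
by rewrite swap_ket -!ket_pair.
Qed.

Lemma ptrP a X Y : ptr (a *: X + Y) = a * ptr X + ptr Y.
Proof. by rewrite /ptr mulr_sumr -big_split; apply: eq_bigr => p _; rewrite dotpP. Qed.

(** As $(1+sF)^2=2(1+sF)$, the vectors $(1+sF)|p\rangle$ resolve $2\operatorname{Tr}((1+sF)X)$ into
    vector functionals, as [schur_sum_ge0] requires. *)
Lemma ptr_swap_sum X (s : C) : linear X -> s^* = s -> s ^+ 2 = 1 ->
  \sum_p dotp ((ket p : Q) + s *: swap (ket p)) (X ((ket p : Q) + s *: swap (ket p))) =
  (ptr X + s * swap_ptr X) *+ 2.
Proof.
move=> Xl sR s1.
have e1 : ptr X = \sum_p dotp (swap (ket p)) (X (swap (ket p))).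
  rewrite /ptr (reindex pswap (onW_bij _ pswap_bij)) /=.
  by apply: eq_bigr => p _; rewrite swap_ket.
have e2 : swap_ptr X = \sum_p dotp (ket p) (X (swap (ket p))).
  rewrite /swap_ptr (reindex pswap (onW_bij _ pswap_bij)) /=.
  by apply: eq_bigr => -[i j] _; rewrite !swap_ket.
rewrite (eq_bigr _ (fun p _ => dotp_add_scale _ _ Xl sR s1)) big_split /= big_split /=.
by rewrite -e1 -mulr_sumr big_split /= -e2 mulrnDl -/(swap_ptr X); congr (_ + _); ring.
Qed.

(** The same resolution for $\operatorname{Tr}((1-\Phi)X)$; here $1-\Phi$ is a projection, so no
    factor 2 arises. *)
Lemma ptr_ghz_sum X : (0 < d)%N -> linear X ->
  \sum_p dotp ((ket p : Q) - max_entangled (ket p)) (X ((ket p : Q) - max_entangled (ket p))) =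
  ptr X - d%:R^-1 * dotp ghz (X ghz).
Proof.
move=> d0 Xl.
have dn0 : d%:R != 0 :> C by rewrite pnatr_eq0 -lt0n.
pose x p := dotp ghz (ket p).
have ghzE : ghz = \sum_p x p *: ket p.
  by rewrite {1}[ghz]ket_expand; apply: eq_bigr => p _; rewrite -dotp_ket /x dotpC dotp_ghz_ket conjC_nat.
have xR p : (x p)^* = x p by rewrite /x dotp_ghz_ket conjC_nat.
have e1 : dotp ghz (X ghz) = \sum_p x p * dotp ghz (X (ket p)).
  by rewrite {2}ghzE linear_op_sum// dotp_sumr; apply: eq_bigr => p _; rewrite linear_opZ// dotpZr.
have e2 : dotp ghz (X ghz) = \sum_p x p * dotp (ket p) (X ghz).
  by rewrite {1}ghzE dotp_suml; apply: eq_bigr => p _; rewrite dotpZl xR.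
have e3 : \sum_p x p ^+ 2 = d%:R := sum_dotp_ghz_sqr.
pose y : C := d%:R^-1.
have yR : y^* = y by apply: conj_Creal; rewrite /y realV realn.
transitivity (\sum_p (dotp (ket p) (X (ket p)) - y * (x p * dotp (ket p) (X ghz))
   - y * (x p * dotp ghz (X (ket p))) + y ^+ 2 * dotp ghz (X ghz) * (x p ^+ 2))).
  by apply: eq_bigr => p _; rewrite max_entangledE dotp_sub_rank_one// -/(x p) xR expr2.
rewrite !big_split /= !sumrN -!mulr_sumr -e2 -e1 e3 /y /ptr.
by field.
Qed.

End max_entangled_theory.

Section channel_theory.
Variables (R : realType) (H K : hilbertType R) (L : (H -> H) -> K -> K).
Hypothesis chL : channel L.
Local Notation C := R[i].

Lemma channel0 : L 0 = 0.
Proof.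
have := channel_linear chL 1 (trace_class0 H) (trace_class0 H).
rewrite scaler0 addr0 scale1r => L0.
by apply: (addrI (L 0)); rewrite addr0 -L0.
Qed.

Lemma channelD (a b : C) X Y : trace_class X -> trace_class Y ->
  L (a *: X + b *: Y) = a *: L X + b *: L Y.
Proof.
move=> tX tY; rewrite channel_linear//; last exact: trace_classZ.
congr (_ + _); rewrite -[b *: Y]addr0 channel_linear// ?channel0 ?addr0//.
exact: trace_class0.
Qed.

Lemma channel_psd X : psd X -> trace_class X -> psd (L X).
Proof.
move=> pX tX; split; first exact: (channel_trace_class chL tX).1.
apply/block_psd1; apply: (channel_cp chL) => //.
by apply/block_psd1; exact: pX.2.
Qed.

End channel_theory.

Lemma scaler_complement (F : fieldType) (V : lmodType F) (q x : F) (u w : V) :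
  q != 0 -> 1 *: u + x *: w = q *: (q^-1 *: (u - w)) + (1 + x) *: w.
Proof.
by move=> q0; rewrite scalerA mulfV// !scale1r scalerDl scale1r addrA subrK.
Qed.

(** * From a PPT channel to the operator inequalities *)

Section cost_of_ppt_channel.
Variables (R : realType) (HA HB : hilbertType R) (T : tensorProduct HA HB).
Variables (I : choiceType) (e : I -> HB) (d : nat).
Local Notation C := R[i].
Local Notation Q := (qudits R d).
Local Notation ket := (@ket R _).
Local Notation Phi := (@max_entangled R d).
Local Notation ghz := (ghz R d).
Local Notation trT := (ptranspose e).
Local Notation trQ := (ptranspose (fun i : 'I_d => ket i)).
Variable rho : T -> T.
Hypotheses (d_gt0 : (0 < d)%N) (onb_e : onb e) (state_rho : is_state rho).

Let dn0 : d%:R != 0 :> C. Proof. by rewrite pnatr_eq0 -lt0n. Qed.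

Lemma max_entangled_le1 (v : Q) : 0 <= dotp v (v - Phi v).
Proof.
rewrite dotpBr max_entangledE dotp_rank_one subr_ge0 -mulrA -normCK.
rewrite mulrC ler_pdivrMr ?ltr0n// mulrC -dotp_ghz.
by rewrite !dotpp -exprMn lerXn2r ?nnegrE ?mulr_ge0// cauchy_schwarz.
Qed.

Lemma max_entangled1 : d = 1%N -> Phi = id.
Proof.
move=> d1; apply/funext => v; rewrite max_entangledE.
have -> : d%:R^-1 = 1 :> C by rewrite d1 invr1.
rewrite scale1r.
have ord1 (i j : 'I_d) : i = j.
  by apply: val_inj; case: i j => [i +] [j +] /=; rewrite d1 !ltnS !leqn0 => /eqP-> /eqP->.
have p0 : 'I_d * 'I_d by split; exact: (Ordinal d_gt0).
have ketE (w : Q) : w = w p0 *: ket p0.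
  rewrite {1}[w]ket_expand (bigD1 p0)//= big1 ?addr0// => p.
  by case: p p0 => [i j] [i0 j0]; rewrite (ord1 i i0) (ord1 j j0) eqxx.
have g1 : ghz p0 = 1.
  by rewrite -dotp_ket dotpC dotp_ghz_ket (ord1 p0.1 p0.2) eqxx conjC_nat.
rewrite [RHS]ketE [ghz]ketE g1 scale1r; congr (_ *: _).
by rewrite dotp_ket.
Qed.

(* The state [G] is the normalised image of the complement of [Phi]; for
   [d = 1] the complement vanishes and [rho] itself serves. *)
Lemma ppt_channel_witness L : channel L -> rho = L Phi ->
  exists G : T -> T, [/\ psd G, has_trace G 1, d = 1%N -> G = rho &
    forall s : C, L (fun v => v + s *: (dotp ghz v *: ghz)) =
      (d%:R ^+ 2 - 1) *: G + (1 + s * d%:R) *: rho].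
Proof.
move=> chL rhoE; have [prho trho] := state_rho.
have tPhi : trace_class Phi := euclid_trace_class (@max_entangled_linear R d).
have tid : trace_class (id : Q -> Q) by exact: euclid_trace_class.
have shiftE (s : C) : (fun v : Q => v + s *: (dotp ghz v *: ghz)) = 1 *: id + (s * d%:R) *: Phi.
  apply/funext => v; rewrite -[RHS]/(1 *: v + (s * d%:R) *: Phi v) scale1r.
  by rewrite max_entangledE !scalerA mulfK.
have [d1|dn1] := eqVneq d 1%N.
  exists rho; split=> // s; rewrite shiftE channelD// -rhoE.
  rewrite -[id](max_entangled1 d1) -rhoE d1 expr1n subrr scale0r add0r.
  by rewrite -scalerDl.
pose q : C := d%:R ^+ 2 - 1.
have q0 : 0 < q.
  by rewrite subr_gt0 -natrX ltr1n (@ltn_exp2r 1 d 2)// ltn_neqAle eq_sym dn1.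
have qn0 : q != 0 by rewrite gt_eqF.
have [Om OmE] : exists Om : Q -> Q, forall v, Om v = q^-1 *: (v - Phi v).
  by exists (fun v => q^-1 *: (v - Phi v)).
have Oml : linear Om.
  move=> a u v; rewrite !OmE max_entangled_linear opprD addrACA -scalerBr.
  by rewrite scalerDr !scalerA mulrC.
have tOm := euclid_trace_class Oml.
have pOm : psd Om.
  split; first exact: euclid_bounded.
  by move=> v; rewrite OmE dotpZr mulr_ge0 ?max_entangled_le1// invr_ge0 ltW.
have trOm : has_trace Om 1.
  rewrite -(_ : ptr Om = 1); first exact: euclid_has_trace.
  have -> : ptr Om = q^-1 * (ptr (id : Q -> Q) - ptr Phi).
    rewrite /ptr -sumrB mulr_sumr; apply: eq_bigr => p _.
    by rewrite OmE dotpZr dotpBr.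
  by rewrite ptr_id ptr_max_entangled// natrX mulVf.
exists (L Om); split=> [|||s]; first exact: channel_psd.
- exact: (channel_trace chL).
- by move=> d1; rewrite d1 in dn1.
(* Split off the part along $\Phi$: $1+sd\Phi=(1-\Phi)+(1+sd)\Phi$. *)
have OmPhi : 1 *: id + (s * d%:R) *: Phi = q *: Om + (1 + s * d%:R) *: Phi.
  apply/funext => v; rewrite -[LHS]/(1 *: v + (s * d%:R) *: Phi v).
  rewrite -[RHS]/(q *: Om v + (1 + s * d%:R) *: Phi v) OmE.
  exact: scaler_complement.
by rewrite shiftE OmPhi (channelD chL _ _ tOm tPhi) -rhoE.
Qed.

Let ktr := @ptransposeP _ _ _ T _ e onb_e.

Lemma ppt_channel_cost L : ppt_channel (fun i : 'I_d => ket i) e L -> rho = L Phi ->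
  exists G : T -> T, [/\ psd G, has_trace G 1,
    ople (- (d%:R - 1) *: trT G) (trT rho) & ople (trT rho) ((d%:R + 1) *: trT G)].
Proof.
move=> [chL cpL] rhoE; have [prho trrho] := state_rho.
have [G [pG trG G1 LE]] := ppt_channel_witness chL rhoE.
have [bG _] := ktr pG trG.1; have [brho _] := ktr prho trrho.1.
have key (s : C) v : s^* = s -> s ^+ 2 = 1 ->
    0 <= (d%:R ^+ 2 - 1) * dotp v (trT G v) + (1 + s * d%:R) * dotp v (trT rho v).
  move=> sR s1; rewrite -!dotpZr -dotpDr.
  have <- : trT (L (trQ (fun v : Q => v + s *: swap v))) v =
      (d%:R ^+ 2 - 1) *: trT G v + (1 + s * d%:R) *: trT rho v.
    by rewrite ptranspose_swap LE ptransposeD//; [exact: trG.1|exact: trrho.1].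
  move: v; apply/block_psd1; apply: (cpL 1%N (fun _ _ => fun v : Q => v + s *: swap v)).
    move=> _ _; apply: euclid_trace_class; apply: linear_id_plus; exact: swap_linear.
  by apply/block_psd1 => v; exact: swap_ge0.
have dp : 0 < d%:R + 1 :> C by rewrite ltr_wpDl.
have lower v : 0 <= (d%:R - 1) * dotp v (trT G v) + dotp v (trT rho v).
  have := key 1 v (conjC1 _) (expr1n _ _).
  rewrite (_ : _ + _ = (d%:R + 1) * ((d%:R - 1) * dotp v (trT G v) + dotp v (trT rho v))).
    by rewrite pmulr_rge0.
  by ring.
have upper v : 0 <= (d%:R + 1) * dotp v (trT G v) - dotp v (trT rho v).
  have [d1|dn1] := eqVneq d 1%N.
    (* For $d=1$ the lower bound reads $\rho^{T_B}\ge0$, and with $G=\rho$ the operator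
       $2G^{T_B}-\rho^{T_B}$ is $\rho^{T_B}$ again. *)
    have := lower v; rewrite G1// d1 subrr mul0r add0r => r0.
    by rewrite mulrDl mul1r addrK.
  have dm : 0 < d%:R - 1 :> C by rewrite subr_gt0 ltr1n ltn_neqAle eq_sym dn1.
  have := key (-1) v; rewrite conjCN conjC1 sqrrN expr1n => /(_ erefl erefl).
  rewrite (_ : _ + _ = (d%:R - 1) * ((d%:R + 1) * dotp v (trT G v) - dotp v (trT rho v))).
    by rewrite pmulr_rge0.
  by ring.
have bB (X Y : T -> T) (a b : C) : bounded_linear X -> bounded_linear Y ->
    bounded_linear (a *: X + b *: Y).
  move=> bX bY; apply: bounded_linearPZ => //; rewrite -[_ *: _]addr0.
  by apply: bounded_linearPZ => //; exact: bounded_linear0.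
exists G; split=> //; split.
- by rewrite -[trT rho]scale1r scaleNr opprK; exact: bB.
- move=> v; rewrite -[(_ - _) v]/(trT rho v - (- (d%:R - 1)) *: trT G v).
  by rewrite scaleNr opprK dotpDr dotpZr addrC.
- by rewrite -[trT rho]scale1r -scaleNr; exact: bB.
- move=> v; rewrite -[(_ - _) v]/((d%:R + 1) *: trT G v - trT rho v).
  by rewrite dotpBr dotpZr.
Qed.

End cost_of_ppt_channel.

Lemma scaler_combination (F : fieldType) (V : lmodType F) (a x y z w : F) (u v : V) :
  (a * x + y) *: u + (a * z + w) *: v =
  a *: (x *: u + z *: v) + (y *: u + w *: v).
Proof. by rewrite !scalerDl scalerDr !scalerA addrACA. Qed.

(** * From the operator inequalities to a PPT channel *)

Section ppt_channel_construction.
Variables (R : realType) (HA HB : hilbertType R) (T : tensorProduct HA HB).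
Variables (I : choiceType) (e : I -> HB) (d : nat).
Local Notation C := R[i].
Local Notation Q := (qudits R d).
Local Notation ket := (@ket R _).
Local Notation Phi := (@max_entangled R d).
Local Notation ghz := (ghz R d).
Local Notation trT := (ptranspose e).
Local Notation trQ := (ptranspose (fun i : 'I_d => ket i)).
Variables rho G : T -> T.
Hypotheses (d_gt0 : (0 < d)%N) (onb_e : onb e) (state_rho : is_state rho).
Hypotheses (psd_G : psd G) (trace_G : has_trace G 1).
Hypothesis lower : ople (- (d%:R - 1) *: trT G) (trT rho).
Hypothesis upper : ople (trT rho) ((d%:R + 1) *: trT G).

Let dn0 : d%:R != 0 :> C. Proof. by rewrite pnatr_eq0 -lt0n. Qed.

(** This is $\operatorname{Tr}(\Phi X)$. *)
Let f (X : Q -> Q) : C := d%:R^-1 * dotp ghz (X ghz).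

(* [X |-> Tr(Phi X) rho + Tr((1 - Phi) X) G] *)
Let L (X : Q -> Q) : T -> T := f X *: rho + (ptr X - f X) *: G.

Let fP a X Y : f (a *: X + Y) = a * f X + f Y.
Proof. by rewrite /f -[(_ + _) ghz]/(a *: X ghz + Y ghz) dotpP; ring. Qed.

Let tc_lin (X : Q -> Q) : trace_class X -> linear X.
Proof. by case=> -[]. Qed.

Let LE X v : L X v = f X *: rho v + (ptr X - f X) *: G v.
Proof. by []. Qed.

Let L_max_entangled : rho = L Phi.
Proof.
have f1 : f Phi = 1 by rewrite /f ghz_max_entangled// mulVf.
apply/funext => v.
by rewrite LE f1 ptr_max_entangled// subrr scale0r addr0 scale1r.
Qed.

Let has_trace_L X t : has_trace X t -> has_trace (L X) t.
Proof.
move=> Xt; have [_ rho1] := state_rho.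
(* The two coefficients of [L X] add up to $\operatorname{Tr}X$. *)
have tE : t = f X * 1 + (ptr X - f X) * 1 by rewrite !mulr1 addrC subrK; exact: euclid_traceE.
rewrite tE.
exact: (has_tracePZ (f X) rho1 (has_traceZ (ptr X - f X) trace_G)).
Qed.

Let trace_class_L X : trace_class (L X).
Proof.
by apply: trace_classPZ; [exact: state_rho.2.1|apply: trace_classZ; exact: trace_G.1].
Qed.

(** Reduces block positivity of $X\mapsto a(X)Y+b(X)Z$ to two Schur sums. *)
Let block_sum n (v : 'I_n -> T) (a b : 'I_n -> 'I_n -> C) (Y Z : T -> T)
    (N : 'I_n -> 'I_n -> T -> T) :
  (forall k l, dotp (v k) (N k l (v l)) =
     a k l * dotp (v k) (Y (v l)) + b k l * dotp (v k) (Z (v l))) ->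
  0 <= \sum_k \sum_l a k l * dotp (v k) (Y (v l)) ->
  0 <= \sum_k \sum_l b k l * dotp (v k) (Z (v l)) ->
  0 <= \sum_(k < n) \sum_(l < n) dotp (v k) (N k l (v l)).
Proof.
move=> NE a0 b0; have := addr_ge0 a0 b0; rewrite -big_split /=.
rewrite (eq_bigr (fun k => \sum_l dotp (v k) (N k l (v l)))) => [//|k _].
by rewrite -big_split /=; apply: eq_bigr => l _; rewrite NE.
Qed.

Let channel_L : channel L.
Proof.
split.
- move=> a X Y tX tY; apply/funext => v.
  rewrite -[RHS]/(a *: L X v + L Y v) !LE fP ptrP.
  rewrite -scaler_combination; congr (_ + _ *: _); ring.
- by move=> X _; exact: trace_class_L.
- exact: has_trace_L.
- move=> n X tX X0 v.
  have Xl k l : linear (X k l) by exact: tc_lin.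
  apply: (@block_sum n v (fun k l => f (X k l)) (fun k l => ptr (X k l) - f (X k l))
    rho G (fun k l => L (X k l))).
  + by move=> k l; rewrite LE dotpDr !dotpZr.
  + rewrite (_ : \sum_k _ = d%:R^-1 *
      \sum_k \sum_l dotp ghz (X k l ghz) * dotp (v k) (rho (v l))).
      by rewrite mulr_ge0 ?invr_ge0//; apply: schur_product_ge0 => //; exact: state_rho.1.
    rewrite mulr_sumr; apply: eq_bigr => k _; rewrite mulr_sumr; apply: eq_bigr => l _.
    by rewrite /f mulrA.
  + have := schur_sum_ge0 (fun p => (ket p : Q) - Phi (ket p)) v Xl X0 psd_G.
    congr (is_true (0 <= _)); apply: eq_bigr => k _; apply: eq_bigr => l _.
    by rewrite ptr_ghz_sum.
Qed.

Let ppt_L : completely_positive (fun X : Q -> Q => trT (L (trQ X))).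
Proof.
move=> n X tX X0 v.
have Xl k l : linear (X k l) by exact: tc_lin.
have [prho trrho] := state_rho.
pose pm (s : C) k l := \sum_p dotp ((ket p : Q) + s *: swap (ket p))
  (X k l ((ket p : Q) + s *: swap (ket p))).
have pmE s k l : s^* = s -> s ^+ 2 = 1 ->
    pm s k l = (ptr (X k l) + s * swap_ptr (X k l)) *+ 2.
  by move=> sR s1; rewrite /pm ptr_swap_sum.
have r2 : (-1) ^+ 2 = 1 :> C by rewrite sqrrN expr1n.
have rN : (-1)^* = -1 :> C by rewrite conjCN conjC1.
(* With $t=\operatorname{Tr}X$ and $w=\operatorname{Tr}(FX)$, the values [pm] are $2(t\pm w)$; the
   factor $1/(4d)$ makes the combination below equal to $\frac wd\rho^{T_B}+(t-\frac wd)G^{T_B}$. *)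
pose q : C := (4 * d%:R)^-1.
have q0 : 0 <= q by rewrite invr_ge0 mulr_ge0.
have scale_sum (a : 'I_n -> 'I_n -> C) (Z : T -> T) :
    0 <= \sum_k \sum_l a k l * dotp (v k) (Z (v l)) ->
    0 <= \sum_k \sum_l (q * a k l) * dotp (v k) (Z (v l)).
  move=> a0; have := mulr_ge0 q0 a0; congr (is_true (0 <= _)).
  rewrite mulr_sumr; apply: eq_bigr => k _; rewrite mulr_sumr; apply: eq_bigr => l _.
  by rewrite mulrA.
apply: (@block_sum n v (fun k l => q * pm 1 k l) (fun k l => q * pm (-1) k l)
  (trT rho - (- (d%:R - 1)) *: trT G) ((d%:R + 1) *: trT G - trT rho) (fun k l => trT (L (trQ (X k l))))).
- move=> k l.
  rewrite /L ptransposeD//; [|exact: trrho.1|exact: trace_G.1].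
  rewrite ptr_ptranspose// /f ghz_ptranspose//.
  rewrite !pmE ?conjC1 ?expr1n//.
  set t := ptr _; set w := swap_ptr _.
  rewrite -[X in dotp _ X = _]/(d%:R^-1 * w *: trT rho (v l) + (t - d%:R^-1 * w) *: trT G (v l)).
  rewrite -[X in _ = _ * dotp _ X + _]/(trT rho (v l) - (- (d%:R - 1)) *: trT G (v l)).
  rewrite -[X in _ = _ + _ * dotp _ X]/((d%:R + 1) *: trT G (v l) - trT rho (v l)).
  rewrite !(dotpBr, dotpDr, dotpZr) /q.
  by field.
- by apply: scale_sum; apply: schur_sum_ge0.
- by apply: scale_sum; apply: schur_sum_ge0.
Qed.

Lemma ppt_channel_exists : exists2 L : (Q -> Q) -> T -> T,
  ppt_channel (fun i : 'I_d => ket i) e L & rho = L Phi.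
Proof. by exists L; [split; [exact: channel_L|exact: ppt_L]|exact: L_max_entangled]. Qed.

End ppt_channel_construction.

Theorem proposition1 (R : realType) (HA HB : hilbertType R)
    (HAB : tensorProduct HA HB) (IB : choiceType) (eB : IB -> HB)
    (rho : HAB -> HAB) :
  separable HAB -> onb eB -> is_state rho ->
  ppt_exact_cost eB rho =
  ereal_inf [set (log2 (m%:R : R))%:E | m in [set m : nat | (0 < m)%N /\
    exists G : HAB -> HAB,
      [/\ psd G,
          has_trace G 1,
          ople (- (m%:R - 1) *: ptranspose eB G) (ptranspose eB rho) &
          ople (ptranspose eB rho) ((m%:R + 1) *: ptranspose eB G)]]].
Proof.
move=> _ onbB srho; rewrite /ppt_exact_cost; congr (ereal_inf (_ @` _)).
apply/seteqP; split=> d /= [d0].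
  by case=> L pptL rhoE; split=> //; exact: ppt_channel_cost pptL rhoE.
case=> G [pG tG lo up]; split=> //.
exact: ppt_channel_exists tG lo up.
Qed.
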